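(* If $H$ is a left pseudogalaxy or a $C_5$-co-chain, then $H$ satisfies the Erdős–Hajnal Conjecture: there exists $\epsilon(H)>0$ such that every tournament $T$ not containing $H$ as a subtournament contains a transitive subtournament on at least $|T|^{\epsilon(H)}$ vertices.
   Context: Tournaments are finite; subtournament = induced subtournament; transitive = no directed cycle. The complement of a tournament is obtained by reversing all edges. Given an ordering of the vertex set, an edge $(x,y)$ is backward if $y$ precedes $x$; a tournament on an ordered vertex set is determined by its backward edges. For an ordering $\theta=(v_1,\dots,v_n)$ of $V(T)$, $B(T,\theta)$ is the undirected graph on $V(T)$ whose edges are the pairs joined by backward edges. A right (resp. left) star is an induced subgraph of $B(T,\theta)$ that is a star $K_{1,t}$ whose center is the last (resp. first) of its vertices in $\theta$ (for $t=1$ either vertex may be the center). $T$ is a galaxy if for some ordering $\theta$ (a galaxy ordering) every component of $B(T,\theta)$ is a left star, a right star or a singleton, and no center of a star lies between two leaves of another star; non-singleton components are the stars. Product: for tournaments $H_1,H_2$ with disjoint vertex sets and injective $f_1,f_2$ into $\mathbb{N}$ with disjoint images, with $\theta_i$ ordering $V(H_i)$ by increasing $f_i$ and $\theta$ ordering $V(H_1)\cup V(H_2)$ by the combined values, $H_1^{f_1}\oplus H_2^{f_2}$ is the tournament on $V(H_1)\cup V(H_2)$ whose backward edges under $\theta$ are exactly those of $H_1$ under $\theta_1$ and of $H_2$ under $\theta_2$. Right pseudogalaxy: $H_l$ on $h_1,\dots,h_7$ with backward edges under $(h_1,\dots,h_7)$ exactly $(h_4,h_1),(h_6,h_2),(h_6,h_1),(h_5,h_3),(h_7,h_5)$;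 $G$ a galaxy with galaxy ordering $(g_1,\dots,g_r)$, $1\le s\le r$ such that no star of $G$ has one leaf in $\{g_1,\dots,g_s\}$ and another in $\{g_{s+1},\dots,g_r\}$; $\rho_1(h_i)=i$ ($i\le6$), $\rho_1(h_7)=7+s$; $\rho_2(g_u)=6+u$ ($u\le s$), $\rho_2(g_u)=7+u$ ($u>s$); then $H_l^{\rho_1}\oplus G^{\rho_2}$ is a right pseudogalaxy. A left pseudogalaxy is the complement of a right pseudogalaxy. $C_5$-chain: $H_l'$ on $h_1,\dots,h_6$ with backward edges under $(h_1,\dots,h_6)$ exactly $(h_4,h_1),(h_5,h_2),(h_5,h_1),(h_6,h_3)$, $\rho_1'(h_i)=i$ ($i\le5$), $\rho_1'(h_6)=7$; for an integer $t\ge0$, $P_{2t+1}$ on $p_1,\dots,p_{2t+1}$ with backward edges under $(p_1,\dots,p_{2t+1})$ exactly $(p_{2i},p_{2i-1})$, $1\le i\le t$, $\rho_2'(p_{2i+1})=2i+6$, $\rho_2'(p_{2i})=2i+7$; a $C_5$-chain is $H_l'^{\rho_1'}\oplus P_{2t+1}^{\rho_2'}$. A $C_5$-co-chain is the complement of a $C_5$-chain. *)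

(* Defs.v *)
From mathcomp Require Import all_boot all_order all_algebra zify.
From mathcomp Require Import reals exp.

Set Implicit Arguments.
Unset Strict Implicit.
Unset Printing Implicit Defensive.

Record tournament := Tournament {
  vert :> finType;
  arc : rel vert;
  arc_irr : irreflexive arc;
  arc_total : forall x y, x != y -> arc x y = ~~ arc y x }.

Definition isomorphic (H T : tournament) : Prop :=
  exists2 phi : H -> T, bijective phi & {mono phi : x y / arc x y}.

Section Reversal.
Variable T : tournament.

Definition rev_arc : rel T := fun x y => arc y x.

Lemma rev_arc_irr : irreflexive rev_arc.
Proof. by move=> x; exact: arc_irr. Qed.

Lemma rev_arc_total x y : x != y -> rev_arc x y = ~~ rev_arc y x.
Proof. by rewrite /rev_arc eq_sym => /arc_total. Qed.

Definition complement : tournament := Tournament rev_arc_irr rev_arc_total.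

End Reversal.

Section Subtournament.
Variables (T : tournament) (S : {set T}).

Definition sub_arc : rel {x | x \in S} := fun x y => arc (val x) (val y).

Lemma sub_arc_irr : irreflexive sub_arc.
Proof. by move=> x; exact: arc_irr. Qed.

Lemma sub_arc_total x y : x != y -> sub_arc x y = ~~ sub_arc y x.
Proof. by move=> xy; exact: arc_total. Qed.

Definition subtournament : tournament := Tournament sub_arc_irr sub_arc_total.

End Subtournament.

Definition contains (T H : tournament) : Prop :=
  exists S : {set T}, isomorphic H (subtournament S).

Definition transitive_tournament (T : tournament) : Prop :=
  forall c : seq T, c != [::] -> ~~ (cycle (@arc T) c && uniq c).

(* An ordering (v_1, ..., v_n) is encoded by the injective numbering
   v_i |-> i; more generally an injective f : V -> nat stands for the ordering
   of V by increasing values of f. *)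

Definition backward (T : tournament) (f : T -> nat) : rel T :=
  fun x y => arc x y && (f y < f x).

Definition backgraph (T : tournament) (f : T -> nat) : rel T :=
  fun x y => backward f x y || backward f y x.

(* Only the pairs (x, y) of B with f y < f x are relevant. *)
Section OfBackward.
Variables (V : finType) (f : V -> nat) (f_inj : injective f) (B : rel V).

Definition ob_arc : rel V := fun x y =>
  if f y < f x then B x y else (f x < f y) && ~~ B y x.

Lemma ob_arc_irr : irreflexive ob_arc.
Proof. by move=> x; rewrite /ob_arc ltnn. Qed.

Lemma ob_arc_total x y : x != y -> ob_arc x y = ~~ ob_arc y x.
Proof.
rewrite -(inj_eq f_inj) /ob_arc.
by case: ltngtP => //= _ _; rewrite negbK.
Qed.

Definition of_backward : tournament := Tournament ob_arc_irr ob_arc_total.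

End OfBackward.

Definition sum_fun (V1 V2 : Type) (f1 : V1 -> nat) (f2 : V2 -> nat)
    (u : V1 + V2) : nat :=
  match u with inl x => f1 x | inr y => f2 y end.

Definition sum_rel (V1 V2 : Type) (B1 : rel V1) (B2 : rel V2) :
    rel (V1 + V2) := fun u v =>
  match u, v with
  | inl x, inl y => B1 x y
  | inr x, inr y => B2 x y
  | _, _ => false
  end.

(* Injectivity of sum_fun f1 f2 says that f1 and f2 are injective with disjoint
   images. *)
Definition product (H1 H2 : tournament) (f1 : H1 -> nat) (f2 : H2 -> nat)
    (f12_inj : injective (sum_fun f1 f2)) : tournament :=
  of_backward f12_inj (sum_rel (backward f1) (backward f2)).

Section Galaxy.
Variables (G : tournament) (f : G -> nat).

Definition components : {set {set G}} :=
  [set [set y | connect (backgraph f) x y] | x in G].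

Definition star_with_center (K : {set G}) (c : G) : Prop :=
  [/\ 1 < #|K|, c \in K &
      {in K &, forall x y, backgraph f x y = ((x == c) (+) (y == c))}].

Definition left_star (K : {set G}) (c : G) : Prop :=
  star_with_center K c /\ {in K, forall x, f c <= f x}.

Definition right_star (K : {set G}) (c : G) : Prop :=
  star_with_center K c /\ {in K, forall x, f x <= f c}.

Definition stars : {set {set G}} := [set K in components | 1 < #|K|].

(* A star with two vertices is both a left and a right star, so its center is
   a matter of choice: ctr K is the chosen center of the star K. *)
Definition leaves (ctr : {set G} -> G) (K : {set G}) : {set G} := K :\ ctr K.

Definition is_numbering : Prop :=
  injective f /\ forall x, 1 <= f x <= #|{: G}|.

Definition galaxy_ordering (ctr : {set G} -> G) : Prop :=
  [/\ is_numbering,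
      forall K, K \in components ->
         [\/ #|K| = 1, left_star K (ctr K) | right_star K (ctr K)] &
      forall K K', K \in stars -> K' \in stars -> K != K' ->
         {in leaves ctr K' &, forall x y, ~~ (f x < f (ctr K) < f y)}].

Lemma galaxy_numbering ctr : galaxy_ordering ctr -> is_numbering.
Proof. by case. Qed.

End Galaxy.

Definition numbering (n : nat) (i : 'I_n) : nat := i.+1.

Lemma numbering_inj n : injective (@numbering n).
Proof. by move=> i j [/val_inj]. Qed.

Definition of_pairs (n : nat) (B : seq (nat * nat)) : tournament :=
  of_backward (@numbering_inj n)
    (fun i j => (numbering i, numbering j) \in B).

Definition Hl : tournament :=
  of_pairs 7 [:: (4, 1); (6, 2); (6, 1); (5, 3); (7, 5)].

Definition rho1 (s : nat) (h : Hl) : nat :=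
  let i := numbering h in if i <= 6 then i else 7 + s.

Definition rho2 (G : tournament) (g : G -> nat) (s : nat) (x : G) : nat :=
  if g x <= s then 6 + g x else 7 + g x.

Lemma rho_inj (G : tournament) (g : G -> nat) (s : nat) :
  is_numbering g -> injective (sum_fun (@rho1 s) (rho2 g s)).
Proof.
case=> g_inj g_bnd [x|x] [y|y] /=; rewrite /rho1 /rho2 /numbering.
- move=> e; congr inl; apply: val_inj => /=; move: e.
  have := ltn_ord x; have := ltn_ord y; do 2!case: ifP; lia.
- have := ltn_ord x; have /andP[] := g_bnd y; do 2!case: ifP; lia.
- have := ltn_ord y; have /andP[] := g_bnd x; do 2!case: ifP; lia.
- by move=> e; congr inr; apply: g_inj; move: e; do 2!case: ifP; lia.
Qed.

Definition right_pseudogalaxy (H : tournament) : Prop :=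
  exists (G : tournament) (g : G -> nat) (ctr : {set G} -> G) (s : nat)
    (g_gal : galaxy_ordering g ctr),
  [/\ 1 <= s <= #|{: G}|,
      forall K, K \in stars g ->
         {in leaves ctr K &, forall x y, ~~ (g x <= s < g y)} &
      isomorphic H (product (rho_inj (s := s) (galaxy_numbering g_gal)))].

Definition left_pseudogalaxy (H : tournament) : Prop :=
  exists2 H', right_pseudogalaxy H' & isomorphic H (complement H').

Definition Hl' : tournament :=
  of_pairs 6 [:: (4, 1); (5, 2); (5, 1); (6, 3)].

Definition rho1' (h : Hl') : nat :=
  let i := numbering h in if i <= 5 then i else 7.

Definition P (t : nat) : tournament :=
  of_pairs (2 * t + 1) [seq (2 * i, 2 * i - 1) | i <- iota 1 t].

(* Ordering P t by increasing rho2' puts p_(2i+1) before p_(2i), so the backward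
   edges of P t in the product also include the pairs (p_(2i), p_(2i+1)). *)
Definition rho2' (t : nat) (p : P t) : nat :=
  let j := numbering p in if odd j then j + 5 else j + 7.

Lemma rho'_inj (t : nat) : injective (sum_fun rho1' (@rho2' t)).
Proof.
case=> [x|x] [y|y] /=; rewrite /rho1' /rho2' /numbering.
- move=> e; congr inl; apply: val_inj => /=; move: e.
  have := ltn_ord x; have := ltn_ord y; do 2!case: ifP; lia.
- have := ltn_ord x; do 2!case: ifP; lia.
- have := ltn_ord y; do 2!case: ifP; lia.
- move=> e; congr inr; apply: val_inj => /=; move: e.
  by do 2!case: ifP; lia.
Qed.

Definition C5_chain (H : tournament) : Prop :=
  exists t : nat, isomorphic H (product (@rho'_inj t)).

Definition C5_co_chain (H : tournament) : Prop :=
  exists2 H', C5_chain H' & isomorphic H (complement H').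

Local Open Scope ring_scope.

Definition satisfies_Erdos_Hajnal (R : realType) (H : tournament) : Prop :=
  exists2 eps : R, 0 < eps &
    forall T : tournament, ~ contains T H ->
      exists2 S : {set T}, transitive_tournament (subtournament S) &
        (#|{: T}|%:R : R) `^ eps <= #|S|%:R.

(* Main.v *)
(** Call T K-critical when every set of at least |T|/K vertices contains a transitive
    set of size at least (1 - 1/K) tr(T), where tr(T) is the largest size of a
    transitive set. By induction on |T|, a tournament H that lies in every critical T
    satisfies the conjecture. Reversing all arcs reduces the theorem to right
    pseudogalaxies and C_5-chains.

    A greedy embedding shows that an H-free tournament has two large sets A, B with
    few arcs from B to A; iterating inside B and cleaning up gives a long sequence of
    disjoint slots in which almost all arcs go forward from each vertex. Criticality
    allows some of the slots to be transitive sets of size c tr(T), and implies that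
    between two large slots, or a large and a transitive one, there is always a
    backward arc. In particular almost every vertex of a large slot has a backward
    neighbour in each prescribed transitive slot, and this embeds stars, hence galaxies.

    For C_5 take a backward arc x5 -> x1 around transitive slots A1, A2, A3. If some q
    in between satisfies x5 -> q -> x1, then a backward arc u -> v with
    x1 < v < q < u < x5 completes a C_5; otherwise outneighbours of x5 in A1 and
    inneighbours of x1 in A3 do, with any vertex of A2. The remaining vertices of H are
    attached in both cases, using in the second case of a pseudogalaxy that a further
    backward transitive triple leads to the first case again. *)

Require Import Defs.
From mathcomp Require Import all_boot all_order all_algebra zify.
From mathcomp Require Import boolp reals exp.
Import Defs.

Set Implicit Arguments.
Unset Strict Implicit.
Unset Printing Implicit Defensive.

(** * Transitive sets *)

Section Transitive.
Variable T : tournament.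
Implicit Types A B : {set T}.

Lemma arc_asym (x y : T) : arc x y -> ~~ arc y x.
Proof.
have [->|xy] := eqVneq x y; first by rewrite arc_irr.
by rewrite (arc_total xy).
Qed.

Lemma arc_neq (x y : T) : arc x y -> x != y.
Proof. by apply: contraTneq => ->; rewrite arc_irr. Qed.

Definition trans_set A : bool :=
  [forall x in A, forall y in A, forall z in A, arc x y && arc y z ==> arc x z].

Lemma trans_setP A :
  reflect {in A & &, forall x y z, arc x y -> arc y z -> arc x z} (trans_set A).
Proof.
apply: (iffP idP).
  move=> /forall_inP h x y z xA yA zA xy yz.
  by move: (h x xA) => /forall_inP/(_ y yA)/forall_inP/(_ z zA); rewrite xy yz.
move=> h; apply/forall_inP => x xA; apply/forall_inP => y yA.
by apply/forall_inP => z zA; apply/implyP => /andP[]; exact: h.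
Qed.

Lemma trans_setS A B : B \subset A -> trans_set A -> trans_set B.
Proof.
move=> /subsetP BA /trans_setP tA; apply/trans_setP => x y z /BA + /BA + /BA.
exact: tA.
Qed.

Lemma trans_set_small A : #|A| <= 2 -> trans_set A.
Proof.
move=> A2; apply/trans_setP => x y z xA yA zA xy yz.
have xz : x != z by apply: contraTneq yz => <-; exact: arc_asym.
have /subset_leq_card : [set x; y; z] \subset A.
  by apply/subsetP => t; rewrite !inE => /orP[/orP[]|] /eqP->.
rewrite -setUA cardsU1 cards2 !inE negb_or (arc_neq xy) (arc_neq yz) xz /=.
by move=> h; have := leq_trans h A2.
Qed.

Lemma trans_setU A B : trans_set A -> trans_set B ->
  {in A & B, forall x y, arc x y} -> trans_set (A :|: B).
Proof.
move=> /trans_setP tA /trans_setP tB AB; apply/trans_setP => x y z.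
rewrite !inE => /orP[xA|xB] /orP[yA|yB] /orP[zA|zB] xy yz.
- exact: (tA x y).
- exact: AB.
- by have := arc_asym yz; rewrite AB.
- exact: AB.
- by have := arc_asym xy; rewrite AB.
- by have := arc_asym xy; rewrite AB.
- by have := arc_asym yz; rewrite AB.
- exact: (tB x y).
Qed.

Definition tr A : nat := \max_(B : {set T} | (B \subset A) && trans_set B) #|B|.

Lemma leq_tr A B : B \subset A -> trans_set B -> #|B| <= tr A.
Proof. by move=> BA tB; apply: leq_bigmax_cond; rewrite BA. Qed.

Lemma trE A : exists B : {set T}, [/\ B \subset A, trans_set B & #|B| = tr A].
Proof.
have [|B /andP[BA tB] e] := @eq_bigmax_cond {set T}
    [pred B : {set T} | (B \subset A) && trans_set B] (fun B : {set T} => #|B|).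
  by apply/card_gt0P; exists set0; rewrite inE sub0set trans_set_small ?cards0.
by exists B; split; rewrite // /tr e.
Qed.

(** Sorting needs a total relation, hence the reflexive closure of [arc]; on a transitive set this
    lists the vertices along the arcs. *)
Definition arc_seq A : seq T := sort (fun x y => (x == y) || arc x y) (enum A).

Lemma mem_arc_seq A : arc_seq A =i A.
Proof. by move=> x; rewrite mem_sort mem_enum. Qed.

Lemma arc_seq_uniq A : uniq (arc_seq A).
Proof. by rewrite sort_uniq enum_uniq. Qed.

Lemma size_arc_seq A : size (arc_seq A) = #|A|.
Proof. by rewrite size_sort -cardE. Qed.

Lemma arc_seq_pairwise A : trans_set A -> pairwise (@arc T) (arc_seq A).
Proof.
move=> /trans_setP tA.
pose leT := fun x y : T => (x == y) || arc x y.
have leT_total : {in A &, total leT}.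
  by move=> x y _ _; rewrite /leT; case: eqVneq => //= xy; rewrite (arc_total xy) orNb.
have leT_trans : {in A & &, transitive leT}.
  move=> y x z yA xA zA; rewrite /leT => /predU1P[->//|xy] /predU1P[<-|yz].
    by rewrite xy orbT.
  by rewrite (tA x y z) ?orbT.
have allA : all [in A] (enum A) by apply/allP => x; rewrite mem_enum.
have : pairwise leT (arc_seq A).
  rewrite -(sorted_pairwise_in leT_trans) ?all_sort //.
  exact: (sort_sorted_in leT_total).
have := arc_seq_uniq A.
rewrite uniq_pairwise => u p; have := pairwise_relI leT (fun x y => x != y) (arc_seq A).
rewrite u p; apply: sub_pairwise => x y /=.
by rewrite /leT; case: eqVneq => //= _; rewrite andbT.
Qed.

End Transitive.

Lemma leq_card_double (T : finType) (A B : {set T}) :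
  2 * #|A :\: B| <= #|A| -> B \subset A -> #|A| <= 2 * #|B|.
Proof.
by move=> h BA; have := cardsD A B; rewrite (setIidPr BA); have := subset_leq_card BA; lia.
Qed.

(** * Critical tournaments and slots *)

Section Critical.
Variable T : tournament.
Implicit Types A B Q : {set T}.

Definition crit (K : nat) : bool :=
  [forall A : {set T}, (#|T| <= K * #|A|) ==> (K.-1 * tr [set: T] <= K * tr A)].

Lemma critP K A : crit K -> #|T| <= K * #|A| -> K.-1 * tr [set: T] <= K * tr A.
Proof. by move=> /forallP/(_ A)/implyP. Qed.

(** A smaller constant tests fewer sets and asks for less, so the constants needed by several lemmas
    can be merged into a maximum. *)
Lemma crit_mono K K' : 0 < K' <= K -> crit K -> crit K'.
Proof.
move=> /andP[K'0 KK'] cK; apply/forallP => A; apply/implyP => hA.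
have /(critP cK) h : #|T| <= K * #|A| by apply: leq_trans hA _; rewrite leq_mul.
rewrite -(leq_pmul2l (leq_trans K'0 KK')).
have : K' * (K.-1 * tr [set: T]) <= K' * (K * tr A) by rewrite leq_mul.
rewrite [K * (K' * _)]mulnCA; apply: leq_trans.
by rewrite !mulnA leq_mul2r; apply/orP; right; nia.
Qed.

Lemma tr_gt1 : 1 < #|T| -> 1 < tr [set: T].
Proof.
move=> /card_gt1P[x [y [_ _ xy]]].
have <- : #|[set x; y]| = 2 by rewrite cards2 xy.
by apply: leq_tr; rewrite ?subsetT // trans_set_small // cards2; case: eqP.
Qed.

(** Otherwise a singleton counts as large, and criticality bounds [tr [set: T]], which is at least
    2, by [K / (K - 1) < 2]. *)
Lemma crit_card K : 1 < #|T| -> 2 < K -> crit K -> K < #|T|.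
Proof.
move=> T1 K2 cK; rewrite ltnNge; apply/negP => TK.
have /card_gt1P[x _] := T1.
have : #|T| <= K * #|[set x]| by rewrite cards1 muln1.
move=> /(critP cK).
have : tr [set x] <= 1.
  by have [B [/subset_leq_card + _ <-]] := trE [set x]; rewrite cards1.
by have := tr_gt1 T1; nia.
Qed.

(** A transitive set of outneighbours, or of inneighbours, of a vertex can be extended by that
    vertex. One of the two neighbourhoods is large, so [(K - 1) t <= K (t - 1)] for [t = tr
    [set: T]]. *)
Lemma crit_tr K : 1 < #|T| -> 3 < K -> crit K -> K <= tr [set: T].
Proof.
move=> T1 K3 cK; have /card_gt1P[x _] := T1.
pose N := [set y | arc x y]; pose M := [set y | arc y x].
have NM : #|T| <= 1 + #|N| + #|M|.
  have -> : #|T| = #|[set x] :|: N :|: M|.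
    rewrite -cardsT; apply: eq_card => y; rewrite !inE.
    by case: eqVneq => //= xy; rewrite (arc_total xy) orbN.
  by rewrite (leq_trans (leq_card_setU _ _).1) // leq_add2r (leq_trans (leq_card_setU _ _).1) // cards1.
have extN : tr N < tr [set: T].
  have [B [BN tB <-]] := trE N.
  have xB : x \notin B by apply: (contraNN (subsetP BN x)); rewrite inE arc_irr.
  suff <- : #|x |: B| = #|B|.+1.
    apply: leq_tr; rewrite ?subsetT // trans_setU //; first by rewrite trans_set_small ?cards1.
    by move=> y z; rewrite inE => /eqP-> /(subsetP BN); rewrite inE.
  by rewrite cardsU1 xB.
have extM : tr M < tr [set: T].
  have [B [BM tB <-]] := trE M.
  have xB : x \notin B by apply: (contraNN (subsetP BM x)); rewrite inE arc_irr.
  suff <- : #|B :|: [set x]| = #|B|.+1.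
    apply: leq_tr; rewrite ?subsetT // trans_setU //; first by rewrite trans_set_small ?cards1.
    by move=> y z /(subsetP BM) + /set1P->; rewrite inE.
  by rewrite setUC cardsU1 xB.
have [hN|hN] := leqP #|T| (K * #|N|).
  by have := critP cK hN; nia.
have hM : #|T| <= K * #|M| by nia.
by have := critP cK hM; nia.
Qed.

(** The arc between [x] in slot [i] and [y] in slot [j] respects the order of the slots; a failure
    is a backward arc. *)
Definition fwd (i : nat) (x : T) (j : nat) (y : T) : bool :=
  if i < j then arc x y else arc y x.

Lemma fwdC i x j y : i != j -> fwd i x j y = fwd j y i x.
Proof. by rewrite /fwd; case: ltngtP. Qed.

Lemma fwdNarc i x j y : x != y -> ~~ fwd i x j y -> if i < j then arc y x else arc x y.
Proof.
move=> xy; rewrite /fwd; case: ifP => _; first by rewrite (arc_total xy) negbK.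
by rewrite -(arc_total xy).
Qed.

(** Otherwise a largest transitive subset of [B], of size at least [(1 - 1/K) tr T], and [Q], of
    size more than [tr T / K], would form a transitive set that is too large. *)
Lemma crit_complete K k i j B Q : crit K -> 1 < #|T| -> k < K ->
  #|T| <= k * #|B| -> trans_set Q -> tr [set: T] <= k * #|Q| ->
  i != j -> ~ {in B & Q, forall x y, fwd i x j y}.
Proof.
move=> cK T1 kK hB tQ hQ ij BQ.
have [C [CB tC eC]] := trE B.
have disj : C :&: Q = set0.
  apply/setP => x; rewrite !inE; apply/andP => -[/(subsetP CB) xB xQ].
  by have := BQ x x xB xQ; rewrite /fwd arc_irr if_same.
have tCQ : trans_set (C :|: Q).
  have [ij'|ij'] := boolP (i < j).
    apply: trans_setU => // x y /(subsetP CB) xB yQ.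
    by have := BQ x y xB yQ; rewrite /fwd ij'.
  rewrite setUC; apply: trans_setU => // x y xQ /(subsetP CB) yB.
  by have := BQ y x yB xQ; rewrite /fwd (negPf ij').
have := leq_tr (subsetT _) tCQ; rewrite cardsU disj cards0 subn0 eC.
have /(critP cK) : #|T| <= K * #|B| by apply: leq_trans hB _; rewrite leq_mul // ltnW.
have := tr_gt1 T1; move: hQ kK; set t := tr _; set b := tr B; set q := #|Q|.
move=> *; have : K * q <= t by nia.
by nia.
Qed.

Lemma crit_bad_small K k c i j B Q : crit K -> 1 < #|T| -> k < K -> c < K ->
  trans_set Q -> tr [set: T] <= k * #|Q| -> i != j ->
  {in B & Q, forall x y, fwd i x j y} -> c * #|B| < #|T|.
Proof.
move=> cK T1 kK cK' tQ hQ ij BQ; rewrite ltnNge; apply/negP => hB.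
apply: (crit_complete cK T1 (k := maxn k c) _ _ tQ _ ij BQ); first by rewrite gtn_max kK.
  by apply: leq_trans hB _; rewrite leq_mul // leq_maxr.
by apply: leq_trans hQ _; rewrite leq_mul // leq_maxl.
Qed.

(** A largest transitive subset of [B] has at least [tr T / 2] vertices and can play the role of [Q]
    in [crit_complete]. *)
Lemma crit_back K c i j A B : crit K -> 1 < #|T| -> c < K -> 2 < K ->
  #|T| <= c * #|A| -> #|T| <= c * #|B| -> i != j ->
  exists x y, [/\ x \in A, y \in B & ~~ fwd i x j y].
Proof.
move=> cK T1 cK' K2 hA hB ij.
have [Q [QB tQ eQ]] := trE B.
have hQ : tr [set: T] <= maxn 2 c * #|Q|.
  have /(critP cK) : #|T| <= K * #|B| by apply: leq_trans hB _; rewrite leq_mul // ltnW.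
  by rewrite -eQ; move: (tr _) => t h; nia.
have hA' : #|T| <= maxn 2 c * #|A| by apply: leq_trans hA _; rewrite leq_mul // leq_maxr.
have [/existsP[x /existsP[y /and3P[]]]|nex] :=
    boolP [exists x, exists y, [&& x \in A, y \in B & ~~ fwd i x j y]].
  by move=> *; exists x, y.
case: (crit_complete cK T1 _ hA' tQ hQ ij); first by rewrite gtn_max K2.
move=> x y xA /(subsetP QB) yB; apply: contraNT nex => h.
by apply/existsP; exists x; apply/existsP; exists y; rewrite xA yB.
Qed.

End Critical.

Section Slots.
Variable T : tournament.
Implicit Types (X : nat -> {set T}) (D : seq (nat * T)) (tau : pred nat).

(** [tau] marks the large slots, of linear size; the others are transitive sets of size at least
    [tr T / k]. Smoothness is required of every single vertex, so it survives passing to large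
    subsets at the cost of a smaller [l]. Transitive slots with no large slot between them are meant
    to be cut out of one transitive set, whence [slots_run]. *)
Record slots tau n k l X : Prop := Slots {
  slots_lin : forall i, i < n -> tau i -> #|T| <= k * #|X i|;
  slots_trans : forall i, i < n -> ~~ tau i -> trans_set (X i);
  slots_tr : forall i, i < n -> ~~ tau i -> tr [set: T] <= k * #|X i|;
  slots_neq : forall i j x y, i < n -> j < n -> i != j ->
    x \in X i -> y \in X j -> x != y;
  slots_smooth : forall i j x, i < n -> j < n -> i != j -> x \in X i ->
    l * #|[set y in X j | ~~ fwd i x j y]| <= #|X j|;
  slots_run : forall i j x y, i < j -> j < n ->
    (forall m, i <= m <= j -> ~~ tau m) -> x \in X i -> y \in X j -> arc x y }.

(** [D] lists vertices already chosen, with their slots; what survives is joined to them by forward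
    arcs. Entries from slot [j] itself impose nothing. *)
Definition restrict D X (j : nat) : {set T} :=
  [set y in X j | all (fun d => (d.1 == j) || fwd d.1 d.2 j y) D].

Lemma restrict_sub D X j y : y \in restrict D X j -> y \in X j.
Proof. by rewrite inE => /andP[]. Qed.

Lemma restrict_fwd D X j y i x : (i, x) \in D -> i != j -> y \in restrict D X j ->
  fwd i x j y.
Proof. by move=> xD ij; rewrite inE => /andP[_ /allP/(_ _ xD)] /=; rewrite (negPf ij). Qed.

(** Each of the at most [l] entries of [D] excludes at most a fraction [1 / (2 l)] of slot [j]. *)
Lemma restrict_half tau n k l X D j : 0 < l -> slots tau n k (2 * l) X ->
  {in D, forall d, d.1 < n /\ d.2 \in X d.1} -> size D <= l -> j < n ->
  #|X j| <= 2 * #|restrict D X j|.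
Proof.
move=> l0 sX hD sD jn; apply: leq_card_double; last first.
  by apply/subsetP => y; exact: restrict_sub.
have {}sD : 2 * size D <= 2 * l by rewrite leq_mul.
suff h : 2 * l * #|X j :\: restrict D X j| <= size D * #|X j|.
  rewrite -(leq_pmul2l l0) mulnCA mulnA; apply: leq_trans h _.
  by rewrite leq_mul2r -(leq_pmul2l (m := 2)) // sD orbT.
have -> : X j :\: restrict D X j =
    [set y in X j | has (fun d => (d.1 != j) && ~~ fwd d.1 d.2 j y) D].
  apply/setP => y; rewrite !inE; case: (y \in X j); rewrite ?andbF //= andbT.
  by rewrite -has_predC; apply: eq_has => d /=; rewrite negb_or.
elim: D hD {sD} => [|d D IH] hD /=.
  by rewrite (_ : [set _ in _ | _] = set0) ?cards0 ?muln0 //; apply/setP => y; rewrite !inE andbF.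
rewrite mulSn.
set A := [set y in X j | (d.1 != j) && ~~ fwd d.1 d.2 j y].
set B := [set y in X j | has _ D] in IH *.
apply: (@leq_trans (2 * l * (#|A| + #|B|))).
  rewrite leq_mul2l; apply/orP; right; apply: leq_trans (leq_card_setU A B).1.
  by apply: subset_leq_card; apply/subsetP => y; rewrite !inE => /andP[-> /orP[->|->]] //=; rewrite orbT.
rewrite mulnDr leq_add //; last by apply: IH => e eD; apply: hD; rewrite inE eD orbT.
rewrite /A; have [e|ne] := eqVneq d.1 j.
  by rewrite (_ : [set _ in _ | _] = set0) ?cards0 ?muln0 //; apply/setP => y; rewrite !inE andbF.
by have [|dn dX] := hD d; rewrite ?mem_head //; exact: (slots_smooth sX).
Qed.

Lemma slots_mono tau n k k' l l' X : k <= k' -> l' <= l ->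
  slots tau n k l X -> slots tau n k' l' X.
Proof.
move=> kk ll sX; split.
- by move=> i ni ti; apply: leq_trans (slots_lin sX ni ti) _; rewrite leq_mul.
- exact: slots_trans sX.
- by move=> i ni ti; apply: leq_trans (slots_tr sX ni ti) _; rewrite leq_mul.
- exact: slots_neq sX.
- by move=> i j x ni nj ij xi; apply: leq_trans (slots_smooth sX ni nj ij xi); rewrite leq_mul.
- exact: slots_run sX.
Qed.

(** This makes the greedy choice of vertices repeatable: one round of choices doubles [k] and halves
    [l]. *)
Lemma slots_restrict tau n k l X D : 0 < l -> slots tau n k (2 * l) X ->
  {in D, forall d, d.1 < n /\ d.2 \in X d.1} -> size D <= l ->
  slots tau n (2 * k) l (restrict D X).
Proof.
move=> l0 sX hD sD; have half := restrict_half l0 sX hD sD.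
have sub j : restrict D X j \subset X j by apply/subsetP => y; exact: restrict_sub.
split.
- move=> i ni ti; apply: leq_trans (slots_lin sX ni ti) _.
  by rewrite -mulnA mulnCA leq_mul ?half.
- by move=> i ni ti; apply: trans_setS (sub i) (slots_trans sX ni ti).
- move=> i ni ti; apply: leq_trans (slots_tr sX ni ti) _.
  by rewrite -mulnA mulnCA leq_mul ?half.
- by move=> i j x y ni nj ij /restrict_sub xi /restrict_sub; exact: (slots_neq sX ni nj ij xi).
- move=> i j x ni nj ij /restrict_sub xi; rewrite -(leq_pmul2l (m := 2)) // mulnA.
  apply: leq_trans (half j nj); apply: leq_trans (slots_smooth sX ni nj ij xi).
  rewrite leq_mul2l; apply/orP; right; apply: subset_leq_card; apply/subsetP => y.
  by rewrite !inE => /andP[/andP[-> _] ->].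
- by move=> i j x y ij nj h /restrict_sub xi /restrict_sub; exact: (slots_run sX ij nj h xi).
Qed.

Lemma slots_gt0 tau n k l X i : 1 < #|T| -> slots tau n k l X -> i < n -> 0 < #|X i|.
Proof.
move=> T1 sX ni; have [ti|ti] := boolP (tau i).
  by have := slots_lin sX ni ti; case: #|X i| => //; rewrite muln0; lia.
by have := slots_tr sX ni ti; have := tr_gt1 T1; case: #|X i| => //; rewrite muln0; lia.
Qed.

Lemma slots_bad_small tau n k l X K c i j : crit T K -> 1 < #|T| -> k < K -> c < K ->
  slots tau n k l X -> i < n -> j < n -> i != j -> ~~ tau j ->
  c * #|[set x in X i | [forall y in X j, fwd i x j y]]| < #|T|.
Proof.
move=> cK T1 kK cK' sX ni nj ij tj.
apply: (crit_bad_small cK T1 kK cK' (slots_trans sX nj tj) (slots_tr sX nj tj) ij).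
by move=> x y; rewrite inE => /andP[_ /forall_inP]; apply.
Qed.

Definition hit X i j : {set T} := [set x in X i | [exists y in X j, ~~ fwd i x j y]].

Lemma hitP X i j x : reflect (x \in X i /\ exists2 y, y \in X j & ~~ fwd i x j y)
  (x \in hit X i j).
Proof. by rewrite inE; apply: (iffP andP) => -[-> /exists_inP]. Qed.

(** Fewer than [|T| / (2 k)] vertices of slot [i] have no backward arc to the transitive slot [j],
    and this is at most half of slot [i]. *)
Lemma hit_lin tau n k l X K i j : crit T K -> 1 < #|T| -> 2 * k < K ->
  slots tau n k l X -> i < n -> j < n -> tau i -> ~~ tau j ->
  #|T| <= 2 * k * #|hit X i j|.
Proof.
move=> cK T1 kK sX ni nj ti tj.
have ij : i != j by apply: contraTneq ti => ->.
have kK' : k < K by lia.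
have := slots_bad_small cK T1 kK' kK sX ni nj ij tj.
set B := [set _ in _ | _] => hB.
have := slots_lin sX ni ti.
have -> : X i = B :|: hit X i j.
  apply/setP => x; rewrite !inE -andb_orr.
  rewrite (_ : _ || _ = true) ?andbT //; apply/orP.
  have [h|] := boolP [forall y in X j, fwd i x j y]; first by left.
  by rewrite negb_forall_in; right.
have := (leq_card_setU B (hit X i j)).1.
by nia.
Qed.

End Slots.

(** For each slot of [js], fewer than [|T| / (k * size js)] vertices of [X r] have no backward
    neighbour there, so together they cannot exhaust [X r]. The vertex [b] becomes the center of a
    star and the [y] its leaves. *)
Lemma slots_star (T : tournament) tau n k l (X : nat -> {set T}) K r (js : seq nat) :
  crit T K -> 1 < #|T| -> k < K -> k * size js < K -> slots tau n k l X ->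
  r < n -> {in js, forall j, [/\ j < n, tau r & ~~ tau j]} ->
  exists2 b, b \in X r & {in js, forall j, exists2 y, y \in X j & ~~ fwd r b j y}.
Proof.
move=> cK T1 kK jK sX rn hjs.
pose bad j := [set x in X r | [forall y in X j, fwd r x j y]].
(* The extra [size js'] records the strictness of the summed inequalities. *)
have small (js' : seq nat) : {subset js' <= js} ->
    k * size js * #|[set x in X r | has (fun j => x \in bad j) js']| + size js' <=
    size js' * #|T|.
  elim: js' => [|j js' IH] sub /=.
    by rewrite (_ : [set _ in _ | _] = set0) ?cards0 ?muln0 //; apply/setP => y; rewrite !inE andbF.
  have [jn taur tj] := hjs j (sub j (mem_head _ _)).
  have rj : r != j by apply: contraTneq taur => ->.
  have := slots_bad_small cK T1 kK jK sX rn jn rj tj; rewrite -/(bad j) => hj.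
  have := IH (fun i ij => sub i (@mem_behead _ (j :: js') i ij)).
  set A := [set _ in _ | has _ js']; set A' := [set _ in _ | _].
  have AA : #|A'| <= #|bad j| + #|A|.
    apply: leq_trans (leq_card_setU _ _).1; apply: subset_leq_card; apply/subsetP => x.
    by rewrite !inE => /andP[-> /orP[->|->]] //; rewrite orbT.
  rewrite mulSn; have : k * size js * #|A'| <= k * size js * #|bad j| + k * size js * #|A|.
    by rewrite -mulnDr leq_mul2l AA orbT.
  move=> h1 h2; apply: leq_trans (leq_add hj h2).
  by rewrite addnS addSn ltnS addnA leq_add2r.
have [/exists_inP[b bX /hasPn hb]|] :=
    boolP [exists b in X r, ~~ has (fun j => b \in bad j) js].
  exists b => // j /hb; rewrite inE bX /= negb_forall_in => /exists_inP[y yX yb].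
  by exists y.
rewrite negb_exists_in => /forall_inP hb.
have := small js (fun _ => id).
rewrite (_ : [set _ in _ | _] = X r); last first.
  by apply/setP => x; rewrite !inE; case: (boolP (x \in X r)) => //= /hb; rewrite negbK.
have /card_gt0P[b bX] := slots_gt0 T1 sX rn.
have /negPn/hasP[j jjs _] := hb b bX; have [_ taur _] := hjs j jjs.
have js0 : 0 < size js by case: (js) jjs.
have : size js * #|T| <= size js * (k * #|X r|) by rewrite leq_mul2l (slots_lin sX rn taur) orbT.
by rewrite mulnA [size js * k]mulnC => h1 h2; have := leq_trans h2 h1; rewrite -[leqRHS]addn0 leq_add2l leqNgt js0.
Qed.

(* par sends a leaf to the center of its star and fixes every other vertex. *)
Lemma slots_embed_stars (V : finType) (pos : V -> nat) (par : V -> V) tau n :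
  injective pos -> (forall x, pos x < n) -> (forall x, par (par x) = par x) ->
  (forall x, par x != x -> ~~ tau (pos x) && tau (pos (par x))) ->
  (forall x y m, par x = par y -> par x != x -> par y != y ->
     pos x <= m <= pos y -> ~~ tau m) ->
  exists2 l, 0 < l & forall k, exists2 K, 0 < K &
    forall (T : tournament) (X : nat -> {set T}),
      1 < #|T| -> crit T K -> slots tau n k l X ->
      exists2 phi : V -> T, (forall x, phi x \in X (pos x)) &
        forall x y, pos x < pos y ->
          if (par x == y) || (par y == x) then arc (phi y) (phi x)
          else arc (phi x) (phi y).
Proof.
move=> pos_inj posn parK tau_par tau_run.
(* Induction on the list of stars still to be embedded: the first goes into the given slots, the
   rest into the slots restricted to it. An [r] that is not its own parent is the parent of nothing
   and is skipped. [l] is chosen before [k] because [slots_exist] produces [k] from [l]. *)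
suff hl : forall rs : seq V, uniq rs -> exists2 l, 0 < l &
    forall k, exists2 K, 0 < K &
    forall (T : tournament) (X : nat -> {set T}),
      1 < #|T| -> crit T K -> slots tau n k l X ->
      exists2 phi : V -> T, (forall x, par x \in rs -> phi x \in X (pos x)) &
        forall x y, par x \in rs -> par y \in rs -> pos x < pos y ->
          if (par x == y) || (par y == x) then arc (phi y) (phi x)
          else arc (phi x) (phi y).
  have [l l0 hl'] := hl (enum V) (enum_uniq V).
  exists l => // k; have [K K0 hK] := hl' k; exists K => // T X T1 cK sX.
  have [phi h1 h2] := hK T X T1 cK sX.
  by exists phi => [x|x y]; [apply: h1|apply: h2]; rewrite mem_enum.
elim=> [|r rs IH] /=.
  move=> _; exists 1 => // k; exists 1 => // T X T1 _ _.
  by have /card_gt1P[x _] := T1; exists (fun _ => x).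
move=> /andP[rrs /IH[l l0 hl]] {IH}.
have [parr|parr] := eqVneq (par r) r; last first.
  exists l => // k; have [K K0 hK] := hl k; exists K => // T X T1 cK sX.
  have [phi h1 h2] := hK T X T1 cK sX.
  have nr x : (par x \in r :: rs) = (par x \in rs).
    rewrite inE; case: eqP => //= e; by rewrite -e parK e eqxx in parr.
  by exists phi => [x|x y]; rewrite !nr; [apply: h1|apply: h2].
pose Lf := [seq x <- enum V | (par x == r) && (x != r)].
(* At most [#|V|] vertices are chosen for this star, and [l] must be left for the others. *)
exists (2 * (l + #|V|)); first by lia.
move=> k; have [K K0 hK] := hl (2 * k).
exists (maxn K (k * size Lf + k).+1); first by rewrite leq_max K0.
move=> T X T1 cK sX.
have cK1 : crit T K by apply: crit_mono cK; rewrite K0 leq_maxl.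
have [b bX hb] : exists2 b, b \in X (pos r) & {in [seq pos x | x <- Lf],
    forall j, exists2 y, y \in X j & ~~ fwd (pos r) b j y}.
  apply: (slots_star cK T1 _ _ sX (posn r)); rewrite ?size_map; [lia|lia|].
  move=> j /mapP[x]; rewrite mem_filter => /andP[/andP[/eqP xr xr'] _] ->.
  by have := tau_par x; rewrite xr eq_sym xr' => /(_ isT)/andP[].
have [psi psi_r [psiX psi_b]] : exists2 psi : V -> T, psi r = b &
    (forall x, par x = r -> psi x \in X (pos x)) /\
    (forall x, par x = r -> x != r -> ~~ fwd (pos r) b (pos x) (psi x)).
  (* By [hb], the default value [b] is never taken at a leaf. *)
  pose psi x := if x == r then b else
    odflt b [pick y in X (pos x) | ~~ fwd (pos r) b (pos x) y].
  exists psi; first by rewrite /psi eqxx.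
  have hx x : par x = r -> x != r ->
      psi x \in X (pos x) /\ ~~ fwd (pos r) b (pos x) (psi x).
    move=> xr xr'; rewrite /psi (negPf xr'); case: pickP => [y /andP[]//|h].
    have [|y yX yb] := hb (pos x).
      by apply/mapP; exists x; rewrite // mem_filter xr eqxx xr' mem_enum.
    by have := h y; rewrite yX yb.
  split => x xr; last by move=> xr'; have [] := hx x xr xr'.
  have [->|xr'] := eqVneq x r; first by rewrite /psi eqxx.
  by have [] := hx x xr xr'.
pose D := [seq (pos x, psi x) | x <- enum V & par x == r].
have DP x : par x = r -> (pos x, psi x) \in D.
  by move=> xr; apply/mapP; exists x; rewrite // mem_filter xr eqxx mem_enum.
have sX' : slots tau n (2 * k) l (restrict D X).
  apply: (@slots_mono _ _ _ (2 * k) _ (l + #|V|)); rewrite ?leq_addr //.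
  apply: (slots_restrict _ sX); first by rewrite addn_gt0 l0.
    move=> d /mapP[x]; rewrite mem_filter => /andP[/eqP xr _] -> /=.
    by split; [exact: posn|exact: psiX].
  rewrite size_map size_filter; apply: leq_trans (count_size _ _) _.
  by rewrite -cardE leq_addl.
have [phi phiX phi_arc] := hK T _ T1 cK1 sX'.
exists (fun x => if par x == r then psi x else phi x).
  move=> x; rewrite inE; case: eqP => [xr _|_ /= xrs]; first exact: psiX.
  exact: restrict_sub (phiX x xrs).
have cross x y : par x = r -> par y \in rs ->
    [/\ (par x == y) = false, (par y == x) = false & fwd (pos x) (psi x) (pos y) (phi y)].
  move=> xr yrs; have ry : par y != r by apply: contraNneq rrs => <-.
  split.
  - by apply/eqP => e; case/eqP: ry; rewrite -e xr parr.
  - by apply/eqP => e; case/eqP: ry; rewrite -(parK y) e.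
  - apply: (restrict_fwd (DP x xr)) (phiX y yrs).
    by apply/eqP => /pos_inj e; case/eqP: ry; rewrite -e.
move=> x y; rewrite !inE; case: eqP => [xr|xr] /=; case: eqP => [yr|yr] //= xrs yrs xy.
- rewrite xr yr ![r == _]eq_sym.
  have xy' : x != y by apply: contraTneq xy => ->; rewrite ltnn.
  have psi_neq : psi x != psi y.
    by apply: (slots_neq sX _ _ _ (psiX x xr) (psiX y yr)); rewrite ?posn // neq_ltn xy.
  have [ey|ney] := eqVneq y r.
    have xr' : x != r by rewrite -ey.
    have := psi_b x xr xr'; rewrite -psi_r => /fwdNarc.
    by rewrite -ey eq_sym psi_neq => /(_ isT); rewrite ltnNge (ltnW xy).
  have [ex|nex] := eqVneq x r.
    have := psi_b y yr ney; rewrite -psi_r => /fwdNarc.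
    by rewrite -ex psi_neq xy => /(_ isT).
  (* Two leaves of one star: only transitive slots lie between them. *)
  apply: (slots_run sX xy (posn y) _ (psiX x xr) (psiX y yr)) => m hm.
  by apply: (tau_run x y) => //; rewrite ?xr ?yr // eq_sym.
- have [-> -> ] := cross x y xr yrs; by rewrite /fwd xy.
- have [-> -> ] := cross y x yr xrs; by rewrite /fwd ltnNge ltnW.
- exact: phi_arc.
Qed.

(** * Sparse pairs in H-free tournaments *)

(** Between tournaments an arc-preserving map is injective, there being no loops to map to, and it
    reflects arcs by totality. *)
Lemma contains_hom (T H : tournament) (phi : H -> T) :
  {homo phi : x y / arc x y} -> contains T H.
Proof.
move=> hphi.
have phi_inj : injective phi.
  move=> x y e; apply/eqP; apply: contraT => xy; move: (arc_total xy).
  have [/hphi|_ /esym/negbFE/hphi] := boolP (arc x y); by rewrite e arc_irr.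
have mono_phi : {mono phi : x y / arc x y}.
  move=> x y; have [->|xy] := eqVneq x y; first by rewrite !arc_irr.
  have [/hphi//|nxy] := boolP (arc x y); apply/negbTE.
  by apply/arc_asym/hphi; rewrite (arc_total xy) negbK in nxy.
exists (phi @: setT).
have phiS x : phi x \in phi @: setT by rewrite imset_f.
exists (fun x => exist _ (phi x) (phiS x)) => //.
apply: inj_card_bij => [x y [/phi_inj]//|].
rewrite card_sig -[leqRHS]cardsT -(card_imset _ phi_inj).
by apply/eq_leq/eq_card.
Qed.

Lemma contains_homP (T H : tournament) : contains T H ->
  exists phi : H -> T, {homo phi : x y / arc x y}.
Proof.
move=> [S [phi _ mono_phi]]; exists (fun x => val (phi x)) => x y.
by rewrite -mono_phi.
Qed.

Lemma card_has (T : finType) (I : Type) (A : {set T}) (P : I -> pred T) (js : seq I) :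
  #|[set x in A | has (P^~ x) js]| <= \sum_(j <- js) #|[set x in A | P j x]|.
Proof.
elim: js => [|j js IH] /=.
  by rewrite (_ : [set _ in _ | _] = set0) ?cards0 //; apply/setP => x; rewrite !inE andbF.
rewrite big_cons; apply: leq_trans (leq_add (leqnn _) IH).
apply: leq_trans (leq_card_setU _ _).1; apply: subset_leq_card; apply/subsetP => x.
by rewrite !inE -andb_orr.
Qed.

Lemma exchange_arcs (T : finType) (r : rel T) (A B : {set T}) :
  \sum_(a in A) #|[set b in B | r a b]| = \sum_(b in B) #|[set a in A | r a b]|.
Proof.
under eq_bigr => a _ do rewrite -sum1dep_card big_mkcondr.
rewrite exchange_big; apply: eq_bigr => b _.
by rewrite -sum1dep_card big_mkcondr.
Qed.

Section Pieces.
Variables (T : eqType) (n : nat) (s : seq T).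
Hypotheses (n_gt0 : 0 < n) (ns : n <= size s).

(** Consecutive blocks of equal length; the remainder at the end of [s] is dropped. *)
Definition piece i := take (size s %/ n) (drop (i * (size s %/ n)) s).

Lemma piece_sub i : {subset piece i <= s}.
Proof. by move=> x /mem_take/mem_drop. Qed.

(** Rounding down costs at most a factor 2 because [n <= size s]. *)
Lemma size_piece i : i < n -> size s <= 2 * n * size (piece i).
Proof.
move=> i_n; set q := size s %/ n.
have qs : q * n <= size s by exact: leq_divM.
have q0 : 0 < q by rewrite divn_gt0.
rewrite size_takel; last by rewrite size_drop -/q; nia.
by have := ltn_ceil (size s) n_gt0; rewrite -/q; nia.
Qed.

Lemma piece_pairwise (r : rel T) i j x y : pairwise r s -> i < j ->
  x \in piece i -> y \in piece j -> r x y.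
Proof.
set q := size s %/ n => rs ij xi yj.
have : x \in take (j * q) s.
  move: xi; rewrite /piece take_drop -/q => /mem_drop.
  have /subnKC <- : q + i * q <= j * q by rewrite -mulSn leq_mul2r ij orbT.
  by rewrite [take (_ + _ + _) s]takeD mem_cat => ->.
move=> xj; move: rs; rewrite -{1}(cat_take_drop (j * q) s) pairwise_cat.
by move=> /andP[/allrelP + _]; apply => //; exact: mem_take yj.
Qed.

Lemma piece_neq i j x y : uniq s -> i != j -> x \in piece i -> y \in piece j -> x != y.
Proof.
rewrite uniq_pairwise neq_ltn => us /orP[] ij xi yj; first exact: (piece_pairwise us ij).
by rewrite eq_sym; exact: (piece_pairwise us ij yj xi).
Qed.

End Pieces.

(** Greedy embedding: [x] is sent to some [v] with at least a fraction [1 / l] of every later [V y]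
    on the correct side, and the [V y] shrink accordingly. If no [v] will do, then for a single [y]
    at least a fraction [1 / size vs] of [V x] fails, and this part forms a sparse pair with
    [V y]. *)
Lemma embed_or_sparse (H : tournament) (l : nat) (vs : seq H) : 0 < l -> uniq vs ->
  exists2 k, 0 < k & forall (T : tournament) (t0 : T) (V : H -> {set T}),
    {in vs, forall x, 0 < #|V x|} ->
    (exists phi : H -> T, {in vs, forall x, phi x \in V x} /\
       {in vs &, forall x y, arc x y -> arc (phi x) (phi y)}) \/
    exists x y (A B : {set T}), [/\ x \in vs, y \in vs & x != y] /\
      [/\ A \subset V x, B \subset V y, #|V x| <= k * #|A|, #|V y| <= k * #|B| &
      l * \sum_(a in A) #|[set b in B | arc a b]| <= #|A| * #|B|].
Proof.
move=> l0; elim: vs => [|x vs IH] /=.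
  by move=> _; exists 1 => // T t0 V _; left; exists (fun _ => t0).
move=> /andP[xvs /IH[k' k'0 hk']] {IH}.
(* [size vs] pays for the pigeonhole choice of [y], and [l * k'] for shrinking the sets before the
   recursive call. *)
exists (size vs + l * k'); first by rewrite addn_gt0 muln_gt0 l0 k'0 orbT.
move=> T t0 V hV.
pose r (y : H) (v b : T) := if arc x y then arc v b else arc b v.
pose bad y := [set v in V x | l * #|[set b in V y | r y v b]| < #|V y|].
have [/hasP[y yvs hy]|/hasPn nbad] := boolP (has (fun y => #|V x| <= size vs * #|bad y|) vs).
  have ineq : l * \sum_(a in bad y) #|[set b in V y | r y a b]| <= #|bad y| * #|V y|.
    rewrite big_distrr /= -sum_nat_const; apply: leq_sum => v.
    by rewrite inE => /andP[_ /ltnW].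
  have badV : bad y \subset V x by apply/subsetP => v; rewrite inE => /andP[].
  have xy : x != y by apply: contraNneq xvs => ->.
  have k1 : #|V x| <= (size vs + l * k') * #|bad y|.
    by apply: leq_trans hy _; rewrite leq_mul2r leq_addr orbT.
  have k2 : #|V y| <= (size vs + l * k') * #|V y|.
    by rewrite leq_pmull // addn_gt0 muln_gt0 l0 k'0 orbT.
  (* Few arcs run from [bad y] to [V y] if [arc x y], and from [V y] to [bad y] otherwise. *)
  right; move: ineq; rewrite /r; case: (boolP (arc x y)) => _ ineq.
    exists x, y, (bad y), (V y); rewrite mem_head inE yvs orbT; split => //.
  exists y, x, (V y), (bad y); rewrite mem_head inE yvs orbT eq_sym; split => //; split => //.
  by rewrite exchange_arcs mulnC [leqRHS]mulnC mulnC.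
have [v vV hv] : exists2 v, v \in V x &
    {in vs, forall y, #|V y| <= l * #|[set b in V y | r y v b]|}.
  have [/exists_inP[v vV /hasPn hv]|] :=
      boolP [exists v in V x, ~~ has (fun y => v \in bad y) vs].
    by exists v => // y /hv; rewrite inE vV /= -leqNgt.
  (* Otherwise the sets [bad y], each smaller than [#|V x| / size vs], would cover [V x]. *)
  rewrite negb_exists_in => /forall_inP hall.
  have := card_has (V x) (fun y v => v \in bad y) vs.
  rewrite (_ : [set _ in _ | _] = V x); last first.
    by apply/setP => v; rewrite !inE; case: (boolP (v \in V x)) => //= /hall; rewrite negbK.
  rewrite (_ : \sum_(_ <- _) _ = \sum_(y <- vs) #|bad y|); last first.
    by apply: eq_bigr => y _; apply: eq_card => v; rewrite !inE; case: (v \in V x).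
  move=> hsum.
  have [e0|n0] := posnP (size vs).
    by move: hsum (hV x (mem_head _ _)); rewrite (size0nil e0) big_nil leqn0 => /eqP->.
  have : size vs * \sum_(y <- vs) #|bad y| <= \sum_(y <- vs) (#|V x|.-1).
    by rewrite big_distrr /= !big_seq; apply: leq_sum => y /nbad; rewrite -ltnNge; lia.
  rewrite big_const_seq count_predT iter_addn_0 mulnC leq_pmul2r //.
  have := hV x (mem_head _ _); move: hsum; set S := \sum_(_ <- _) _; lia.
pose V' y := if y \in vs then [set b in V y | r y v b] else V y.
have V'V y : V' y \subset V y.
  by rewrite /V'; case: ifP => // _; apply/subsetP => b; rewrite inE => /andP[].
have V'half y : y \in vs -> #|V y| <= l * #|V' y| by rewrite /V' => yvs; rewrite yvs; exact: hv.
have V'0 : {in vs, forall y, 0 < #|V' y|}.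
  move=> y yvs; have := V'half y yvs; have := hV y; rewrite inE yvs orbT => /(_ isT).
  by case: #|V' y| => //; rewrite muln0; lia.
case: (hk' T t0 V' V'0) => [[phi [phiV phi_arc]]|hsparse]; [left|right].
  exists (fun y => if y == x then v else phi y); split.
    move=> y; rewrite inE; case: eqP => [->|_ /= yvs] //.
    exact: subsetP (V'V y) _ (phiV y yvs).
  move=> y z; rewrite !inE.
  case: (eqVneq y x) => [->|yx] /=; case: (eqVneq z x) => [->|zx] //=.
  - by rewrite arc_irr.
  - move=> _ zvs xz; have := phiV z zvs; rewrite /V' zvs inE /r xz.
    by case/andP.
  - move=> yvs _ yx'; have := phiV y yvs; rewrite /V' yvs inE /r.
    by rewrite (negPf (arc_asym yx')) => /andP[].
  - exact: phi_arc.
case: hsparse => y [z [A [B [[yvs zvs yz] [AV BV hA hB e]]]]]; exists y, z, A, B.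
rewrite !inE yvs zvs !orbT; split=> //; split=> //.
- exact: subset_trans AV (V'V y).
- exact: subset_trans BV (V'V z).
- apply: leq_trans (V'half y yvs) _; rewrite mulnDl -mulnA.
  by apply: leq_trans (leq_addl _ _); rewrite leq_mul2l hA orbT.
- apply: leq_trans (V'half z zvs) _; rewrite mulnDl -mulnA.
  by apply: leq_trans (leq_addl _ _); rewrite leq_mul2l hB orbT.
Qed.

(** Since [T] omits [H], [embed_or_sparse] applied to [#|H|] equal pieces of [S] can only return a
    sparse pair. *)
Lemma sparse_pair (H : tournament) (l : nat) : 0 < l -> exists2 k, 0 < k &
  forall T : tournament, ~ contains T H -> forall S : {set T}, k <= #|S| ->
  exists A B : {set T}, [/\ A \subset S, B \subset S & {in A & B, forall x y, x != y}] /\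
    [/\ #|S| <= k * #|A|, #|S| <= k * #|B| &
      l * \sum_(b in B) #|[set a in A | arc b a]| <= #|A| * #|B|].
Proof.
move=> l0; have [k k0 hk] := @embed_or_sparse H l (enum H) l0 (enum_uniq H).
exists (2 * #|H| * k + #|H| + 1); first lia.
move=> T nTH S hS; have /card_gt0P[t0 _] : 0 < #|S| by lia.
have sS : #|H| <= size (enum S) by rewrite -cardE; lia.
pose V (x : H) := [set y in piece #|H| (enum S) (enum_rank x)].
have cV (x : H) : #|S| <= 2 * #|H| * #|V x|.
  have h0 : 0 < #|H| by apply/card_gt0P; exists x.
  rewrite {1}cardE cardsE (card_uniqP _); first exact: size_piece.
  by rewrite take_uniq // drop_uniq // enum_uniq.
have V0 : {in enum H, forall x, 0 < #|V x|}.
  by move=> x _; have := cV x; case: #|V x| => //; rewrite muln0; lia.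
case: (hk T t0 V V0) => [[phi [_ phi_arc]]|].
  by case: nTH; apply: (@contains_hom _ _ phi) => x y; apply: phi_arc; rewrite mem_enum.
case=> x [y [A [B [[_ _ xy] [AV BV hA hB e]]]]]; exists B, A.
have VS z : V z \subset S.
  by apply/subsetP => t; rewrite inE => /piece_sub; rewrite mem_enum.
split; split.
- exact: subset_trans BV (VS y).
- exact: subset_trans AV (VS x).
- move=> b a /(subsetP BV) + /(subsetP AV); rewrite !inE; apply: piece_neq.
    exact: enum_uniq.
  by apply: contraNneq xy => /ord_inj/enum_rank_inj ->.
- apply: leq_trans (cV y) _; rewrite -addnA mulnDl.
  by apply: leq_trans (leq_addr _ _); rewrite -[leqRHS]mulnA leq_mul2l hB orbT.
- apply: leq_trans (cV x) _; rewrite -addnA mulnDl.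
  by apply: leq_trans (leq_addr _ _); rewrite -[leqRHS]mulnA leq_mul2l hA orbT.
- by rewrite mulnC [leqRHS]mulnC mulnC.
Qed.

(** The first set of a sparse pair starts the chain, and the rest is found inside the second. The
    later sets have at least a share [1 / k] of the second set, so the pair is taken sparse with
    [l * k]. *)
Lemma sparse_chain (H : tournament) (l N : nat) : 0 < l -> exists2 k, 0 < k &
  forall T : tournament, ~ contains T H -> forall S : {set T}, k <= #|S| ->
  exists B : nat -> {set T}, (forall i, i < N -> B i \subset S /\ #|S| <= k * #|B i|) /\
    forall i j, i < j < N -> {in B i & B j, forall x y, x != y} /\
      l * \sum_(b in B j) #|[set a in B i | arc b a]| <= #|B i| * #|B j|.
Proof.
move=> l0; elim: N => [|N [k k0 hk]].
  by exists 1 => // T _ S _; exists (fun _ => S); split=> // i j; rewrite ltn0 andbF.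
have lk0 : 0 < l * k by rewrite muln_gt0 l0.
have [p p0 hp] := @sparse_pair H _ lk0.
exists (p * k); first by rewrite muln_gt0 p0.
move=> T nTH S hS; have pS : p <= #|S| by apply: leq_trans hS; rewrite leq_pmulr.
have [A [B [[AS BS AB] [hA hB e]]]] := hp T nTH S pS.
have kB : k <= #|B| by rewrite -(leq_pmul2l p0); exact: leq_trans hB.
have [C [hC1 hC2]] := hk T nTH B kB.
exists (fun i => if i is i'.+1 then C i' else A); split.
  move=> [|i] hi.
    by split=> //; apply: leq_trans hA _; rewrite leq_mul2r leq_pmulr ?orbT.
  have [CB hC] := hC1 i hi; split; first exact: subset_trans CB BS.
  by apply: leq_trans hB _; rewrite -mulnA leq_mul2l hC orbT.
move=> [|i] [|j] // /andP[ij jN]; last by apply: hC2; rewrite -ltnS ij.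
have [/subsetP CB hC] := hC1 j jN; split; first by move=> x y xA /CB; exact: AB.
rewrite -(leq_pmul2l k0) mulnCA mulnA; apply: (@leq_trans (#|A| * #|B|)).
  apply: leq_trans e; rewrite leq_mul2l; apply/orP; right.
  rewrite [leqRHS](big_setID (C j)) /= (setIidPr _) ?leq_addr //; exact/subsetP.
by rewrite mulnCA leq_mul2l hC orbT.
Qed.

(** * From a sparse chain of sets to slots *)

Section Cleaning.
Variables (T : tournament) (N : nat).
Implicit Types (B C : nat -> {set T}).

Definition bdeg B i v j : nat := #|[set y in B j | ~~ fwd i v j y]|.

(** The averaged form of [slots_smooth]. *)
Definition sparse l B := forall i j, i < N -> j < N -> i != j ->
  l * \sum_(v in B i) bdeg B i v j <= #|B i| * #|B j|.

Lemma bdeg_sub B C i v j : C j \subset B j -> bdeg C i v j <= bdeg B i v j.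
Proof.
move=> /subsetP CB; apply: subset_leq_card; apply/subsetP => y.
by rewrite !inE => /andP[/CB-> ->].
Qed.

Lemma sum_bdegC B i j : i != j ->
  \sum_(v in B i) bdeg B i v j = \sum_(v in B j) bdeg B j v i.
Proof.
move=> ij; rewrite [LHS](exchange_arcs (fun v y => ~~ fwd i v j y)).
apply: eq_bigr => y _; apply: eq_card => v; rewrite !inE; congr (_ && ~~ _).
exact: fwdC.
Qed.

Definition good l B p : {set T} :=
  [set v in B p | ~~ has (fun j => (j != p) && (#|B j| < l * bdeg B p v j)) (iota 0 N)].

Lemma good_sub l B p : good l B p \subset B p.
Proof. by apply/subsetP => v; rewrite inE => /andP[]. Qed.

Lemma good_bdeg l B p v j : v \in good l B p -> j < N -> j != p ->
  l * bdeg B p v j <= #|B j|.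
Proof.
rewrite inE => /andP[_ /hasPn h] jN jp; have := h j.
by rewrite mem_iota jN jp -leqNgt; apply.
Qed.

(** Markov's inequality: for each [j], at most a fraction [1 / (2 N)] of [B p] has too many backward
    arcs to [B j]. *)
Lemma good_half l B p : sparse (2 * N * l) B -> (forall j, j < N -> 0 < #|B j|) ->
  p < N -> #|B p| <= 2 * #|good l B p|.
Proof.
move=> sB B0 pN; apply: leq_card_double (good_sub _ _ _).
pose bad j := [set v in B p | (j != p) && (#|B j| < l * bdeg B p v j)].
have bad_small j : j < N -> 2 * N * #|bad j| <= #|B p|.
  move=> jN; have [->|jp] := eqVneq j p.
    rewrite (_ : bad p = set0) ?cards0 ?muln0 //.
    by apply/setP => v; rewrite !inE eqxx andbF.
  rewrite -(leq_pmul2r (B0 j jN)); apply: leq_trans (sB p j pN jN _); last by rewrite eq_sym.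
  rewrite -!mulnA !leq_mul2l /=; apply/orP; right.
  rewrite -sum_nat_const big_distrr /= [leqRHS](big_setID (bad j)) /=.
  rewrite (setIidPr _); last by apply/subsetP => v; rewrite inE => /andP[].
  apply: leq_trans (leq_addr _ _); apply: leq_sum => v.
  by rewrite inE => /and3P[_ _ /ltnW].
have := card_has (B p) (fun j v => (j != p) && (#|B j| < l * bdeg B p v j)) (iota 0 N).
rewrite (_ : [set _ in _ | _] = B p :\: good l B p); last first.
  by apply/setP => v; rewrite !inE; case: (v \in B p); rewrite ?andbF //= negbK andbT.
move=> h; rewrite -(leq_pmul2l (leq_ltn_trans (leq0n p) pN)) mulnA [N * 2]mulnC.
apply: leq_trans (leq_mul (leqnn _) h) _.
rewrite big_distrr /=.
apply: (@leq_trans (\sum_(j <- iota 0 N) #|B p|)); last first.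
  by rewrite big_const_seq count_predT size_iota iter_addn_0 mulnC.
rewrite !big_seq; apply: leq_sum => j; rewrite mem_iota => /andP[_ jN].
exact: bad_small.
Qed.

(** The first [p] sets are replaced in turn by their good vertices, or by a largest transitive
    subset of these. Such a subset may be too small to inherit an average bound, but goodness bounds
    each vertex separately, so every set of good vertices stays sparse. Each replacement costs a
    factor [2 * N]. *)
Lemma sparse_convert (tau : pred nat) K k p l B : crit T K -> 1 < #|T| -> 2 * k < K -> 2 < K ->
  p <= N -> (forall i, i < N -> #|T| <= k * #|B i|) -> sparse ((2 * N) ^ p * l) B ->
  exists C, [/\ forall i, i < N -> C i \subset B i, sparse l C,
    forall i, i < p ->
      if tau i then #|T| <= 2 * k * #|C i| else trans_set (C i) && (tr [set: T] <= 2 * #|C i|) &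
    forall i, p <= i -> C i = B i].
Proof.
move=> cK T1 kK K2; elim: p l => [|p IH] l pN linB sB.
  by exists B; split=> //; move: sB; rewrite mul1n.
have [|C [CB sC hC eC]] := IH (2 * N * l) (ltnW pN) linB; first by rewrite mulnA -expnSr.
have C0 j : j < N -> 0 < #|C j|.
  move=> jN; have [/hC|/eC->] := ltnP j p.
    case: ifP => _; first by case: #|C j| => //; rewrite muln0; lia.
    by case/andP => _; have := tr_gt1 T1; case: #|C j| => //; lia.
  by have := linB j jN; case: #|B j| => //; rewrite muln0; lia.
have gp := good_half sC C0 pN.
have linG : #|T| <= 2 * k * #|good l C p|.
  apply: leq_trans (linB p pN) _.
  by rewrite -(eC p) // -mulnA mulnCA leq_mul2l gp orbT.
have [D [DG hD]] : exists D : {set T}, D \subset good l C p /\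
    if tau p then #|T| <= 2 * k * #|D| else trans_set D && (tr [set: T] <= 2 * #|D|).
  case: (tau p); first by exists (good l C p).
  have [D [DG tD eD]] := trE (good l C p); exists D; split=> //; rewrite tD eD /=.
  have /(critP cK) : #|T| <= K * #|good l C p|.
    by apply: leq_trans linG _; rewrite leq_mul // ltnW.
  by move: (tr [set: T]) (tr (good l C p)) => t u; nia.
pose E i := if i == p then D else C i.
have EC i : E i \subset C i.
  by rewrite /E; case: eqP => // ->; apply: subset_trans DG (good_sub _ _ _).
have degD j : j < N -> j != p -> l * \sum_(v in D) bdeg E p v j <= #|D| * #|C j|.
  move=> jN jp; rewrite big_distrr /= -sum_nat_const; apply: leq_sum => v /(subsetP DG) vG.
  by apply: leq_trans (good_bdeg vG jN jp); rewrite leq_mul2l bdeg_sub ?orbT.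
have Ep : E p = D by rewrite /E eqxx.
have Ej j : j != p -> E j = C j by rewrite /E => /negPf->.
exists E; split.
- by move=> i iN; apply: subset_trans (EC i) (CB i iN).
- move=> i j iN jN ij; have [ip|ip] := eqVneq i p.
    by rewrite ip in ij *; rewrite Ep Ej 1?eq_sym //; apply: degD; rewrite 1?eq_sym.
  have [jp|jp] := eqVneq j p.
    by rewrite sum_bdegC // mulnC [leqRHS]mulnC mulnC jp Ep Ej //; exact: degD.
  rewrite /bdeg !Ej //; apply: leq_trans (sC i j iN jN ij).
  by rewrite -[leqRHS]mulnA leq_pmull // muln_gt0 (leq_ltn_trans _ pN).
- move=> i; rewrite ltnS leq_eqVlt => /predU1P[->|ip]; first by rewrite Ep.
  by rewrite Ej ?hC // ltn_eqF.
- by move=> i pi; rewrite Ej ?eC ?(ltnW pi) // gtn_eqF.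
Qed.

End Cleaning.

Section Index.
Variable tau : pred nat.

(** The transitive slots of one run share an even index, and each large slot has an odd index of its
    own. Parity thus tells the type, and a run can be cut out of a single set. *)
Definition run_index i : nat := 2 * count tau (iota 0 i) + tau i.

Lemma odd_run_index i : odd (run_index i) = tau i.
Proof. by rewrite /run_index mul2n oddD odd_double; case: (tau i). Qed.

Lemma run_index_ltn i n : i < n -> run_index i < 2 * n.+1.
Proof.
move=> i_n; have := count_size tau (iota 0 i); rewrite size_iota /run_index.
by have := leq_b1 (tau i); lia.
Qed.

Lemma run_index_mono i j : i < j ->
  run_index i < run_index j \/ run_index i = run_index j /\ ~~ tau i.
Proof.
move=> ij; have [m ->] : exists m, j = i + m.+1 by exists (j - i.+1); lia.
rewrite /run_index iotaD count_cat /= add0n.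
have := leq_b1 (tau (i + m.+1)); case: (tau i) => /=; first by lia.
by case: (count tau (iota i.+1 m)) => [|c]; case: (tau (i + m.+1)) => /=; [left|right|left|left]; rewrite ?addn0 ?add0n //; lia.
Qed.

Lemma run_index_eq i j : i <= j -> (forall m, i <= m <= j -> ~~ tau m) ->
  run_index i = run_index j.
Proof.
move=> ij h; have [m e] : exists m, j = i + m by exists (j - i); lia.
rewrite /run_index (negPf (h i _)) ?leqnn // (negPf (h j _)) ?leqnn ?ij //.
rewrite {1}e iotaD count_cat add0n (_ : count tau (iota i m) = 0) ?addn0 //.
apply/eqP; rewrite -leqn0 leqNgt -has_count; apply/hasPn => x.
by rewrite mem_iota -e => /andP[ix xj]; apply: h; rewrite ix ltnW.
Qed.

End Index.

(** In a sparse chain of [N] sets the odd ones are kept large and the even ones made transitive; a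
    last passage to good vertices turns average bounds into bounds for each vertex. Slot [i] is the
    set of index [run_index tau i] or, if transitive, the [i]-th of [n] pieces of that set, so a run
    is ordered inside one transitive set. *)
Lemma slots_exist (H : tournament) (tau : pred nat) n l : 0 < l ->
  exists k K, 0 < K /\ forall T : tournament, 1 < #|T| -> crit T K -> ~ contains T H ->
    exists X : nat -> {set T}, slots tau n k l X.
Proof.
move=> l0; have [n0|n_gt0] := posnP n.
  exists 0, 1; split=> // T _ _ _; exists (fun _ => set0).
  by split=> i; rewrite n0 ?ltn0 // => j x y; rewrite ltn0.
(* In [l3], the factor [2 * n] pays for cutting into pieces and the other 2 for passing to good
   vertices. *)
pose N := 2 * n.+1; pose l3 := 2 * (2 * n * l).
have l3_gt0 : 0 < l3 by rewrite !muln_gt0 n_gt0 l0.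
(* [(2 * N) ^ N] pays for [sparse_convert], and [2 * N] for the last use of [good_half]. *)
have l1 : 0 < (2 * N) ^ N * (2 * N * l3) by rewrite !muln_gt0 expn_gt0 /= in l3_gt0 *; rewrite l3_gt0.
have [k1 k1_gt0 hk1] := @sparse_chain H _ N l1.
exists (4 * k1 + 8 * n), (2 * k1 + 4 * n + 4); split; first by lia.
move=> T T1 cK nTH; set K := 2 * k1 + 4 * n + 4 in cK.
have TK : K < #|T| by apply: crit_card cK => //; rewrite /K; lia.
have trK : K <= tr [set: T] by apply: crit_tr cK => //; rewrite /K; lia.
have [|B [linB chB]] := hk1 T nTH [set: T]; first by rewrite cardsT; move: TK; rewrite /K; lia.
have {}linB i : i < N -> #|T| <= k1 * #|B i| by move=> /linB[_]; rewrite cardsT.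
have sB : sparse N ((2 * N) ^ N * (2 * N * l3)) B.
  have sB' i j : i < j -> j < N -> (2 * N) ^ N * (2 * N * l3) *
      \sum_(v in B j) bdeg B j v i <= #|B j| * #|B i|.
    move=> ij jN; have [|neqB sBij] := chB i j; first by rewrite ij jN.
    rewrite [leqRHS]mulnC; apply: leq_trans sBij; rewrite leq_mul2l; apply/orP; right.
    apply: leq_sum => v vB; apply: subset_leq_card; apply/subsetP => a.
    rewrite !inE => /andP[aB]; rewrite aB /fwd ltnNge (ltnW ij) /= => nav.
    by rewrite (arc_total (y := a)) // eq_sym neqB.
  move=> i j iN jN ij; have [ij'|ij'|ij'] := ltngtP i j; last by rewrite ij' eqxx in ij.
    by rewrite sum_bdegC // mulnC [leqRHS]mulnC mulnC sB'.
  exact: sB'.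
have [] := sparse_convert odd cK T1 _ _ (leqnn N) linB sB; [by rewrite /K; lia..|].
move=> C [CB sC hC _].
have C0 j : j < N -> 0 < #|C j|.
  move=> /hC; case: ifP => _; first by case: #|C j| => //; rewrite muln0; lia.
  by case/andP => _; have := tr_gt1 T1; case: #|C j| => //; lia.
pose G i := good N l3 C i.
have GC i : G i \subset C i by exact: good_sub.
have Ghalf i : i < N -> #|C i| <= 2 * #|G i| by exact: good_half.
have Gsmooth i j v : i < N -> j < N -> i != j -> v \in G i ->
    2 * n * l * bdeg G i v j <= #|G j|.
  move=> iN jN ij vG; rewrite -(leq_pmul2l (m := 2)) //.
  apply: leq_trans (Ghalf j jN); rewrite mulnA -/l3.
  have jn : j != i by rewrite eq_sym.
  by apply: leq_trans (good_bdeg vG jN jn); rewrite leq_mul2l bdeg_sub ?orbT.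
have G_neq i j x y : i < N -> j < N -> i != j -> x \in G i -> y \in G j -> x != y.
  move=> iN jN ij /(subsetP (GC i))/(subsetP (CB i iN)) xB.
  move=> /(subsetP (GC j))/(subsetP (CB j jN)) yB.
  have [ij'|ij'|ij'] := ltngtP i j; last by rewrite ij' eqxx in ij.
    by have [|neqB _] := chB i j; [rewrite ij' jN|exact: neqB].
  by rewrite eq_sym; have [|neqB _] := chB j i; [rewrite ij' iN|exact: neqB].
pose idx := run_index tau.
have idxN i : i < n -> idx i < N by exact: run_index_ltn.
pose X i := if tau i then G (idx i) else [set x in piece n (arc_seq (G (idx i))) i].
have XG i : X i \subset G (idx i).
  rewrite /X; case: ifP => // _; apply/subsetP => x; rewrite inE => /piece_sub.
  by rewrite mem_arc_seq.
have trG i : i < n -> ~~ tau i -> trans_set (G (idx i)) /\ tr [set: T] <= 4 * #|G (idx i)|.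
  move=> ni ti; have := hC _ (idxN i ni); rewrite odd_run_index (negPf ti) => /andP[tC hT].
  split; first exact: trans_setS (GC _) tC.
  by apply: leq_trans hT _; rewrite -[4]/(2 * 2) -mulnA leq_mul2l Ghalf ?idxN.
(* There is at least one vertex for each piece because criticality forces [K <= tr [set: T]]. *)
have nG i : i < n -> ~~ tau i -> n <= size (arc_seq (G (idx i))).
  move=> ni ti; have [_] := trG i ni ti; rewrite size_arc_seq.
  by move: trK; rewrite /K; lia.
have Xn i : i < n -> #|G (idx i)| <= 2 * n * #|X i|.
  move=> ni; rewrite /X; case: ifPn => ti; first by rewrite leq_pmull // muln_gt0.
  have /card_uniqP eu : uniq (piece n (arc_seq (G (idx i))) i).
    by rewrite take_uniq // drop_uniq // arc_seq_uniq.
  rewrite (eq_card (in_set (mem _))) eu.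
  by rewrite -{1}size_arc_seq; apply: size_piece; rewrite ?nG.
have Xrun i j x y : i < j -> j < n -> idx i = idx j -> ~~ tau i ->
    x \in X i -> y \in X j -> arc x y.
  move=> ij nj e ti; have tj : ~~ tau j by rewrite -odd_run_index -/(idx j) -e odd_run_index.
  rewrite /X (negPf ti) (negPf tj) !inE e => xi yj.
  have [tG _] := trG j nj tj; exact: (piece_pairwise (arc_seq_pairwise tG) ij xi yj).
have idx_cases i j : i < n -> j < n -> i != j ->
    (idx i != idx j) /\ (i < j) = (idx i < idx j) \/
    forall x y, x \in X i -> y \in X j -> fwd i x j y.
  move=> ni nj; rewrite neq_ltn => /orP[] ij.
    have [h|[e ti]] := run_index_mono tau ij; [left|right].
      by rewrite /idx h ij ltn_eqF.
    by move=> x y xi yj; rewrite /fwd ij; exact: (Xrun i j).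
  have [h|[e ti]] := run_index_mono tau ij; [left|right].
    by rewrite /idx gtn_eqF // [i < j]ltnNge [_ < run_index _ j]ltnNge (ltnW ij) (ltnW h).
  by move=> x y xi yj; rewrite /fwd ltnNge ltnW //=; exact: (Xrun j i).
exists X; split.
- move=> i ni ti; have := hC _ (idxN i ni); rewrite odd_run_index ti => hT.
  apply: leq_trans hT _; rewrite /X ti mulnDl.
  apply: leq_trans (leq_addr _ _); rewrite -[4]/(2 * 2) -!mulnA leq_mul2l /=.
  by rewrite mulnCA leq_mul2l Ghalf ?idxN ?orbT.
- by move=> i ni ti; apply: trans_setS (XG i) (trG i ni ti).1.
- move=> i ni ti; apply: leq_trans (trG i ni ti).2 _; rewrite mulnDl.
  apply: leq_trans (leq_addl _ _); rewrite -[8]/(4 * 2) -!mulnA leq_mul2l /=.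
  by rewrite mulnA Xn.
- move=> i j x y ni nj ij xi yj; have [[h _]|h] := idx_cases i j ni nj ij.
    exact: (G_neq _ _ _ _ (idxN i ni) (idxN j nj) h (subsetP (XG i) _ xi) (subsetP (XG j) _ yj)).
  apply: contraTneq (h x y xi yj) => ->; by rewrite /fwd arc_irr if_same.
- move=> i j x ni nj ij xi; have [[h e]|h] := idx_cases i j ni nj ij; last first.
    rewrite (_ : [set _ in _ | _] = set0) ?cards0 ?muln0 //; apply/setP => y; rewrite !inE.
    by case: (boolP (y \in X j)) => //= yj; rewrite h.
  have n2 : 0 < 2 * n by rewrite muln_gt0.
  rewrite -(leq_pmul2l n2); apply: leq_trans (Xn j nj); rewrite mulnA.
  apply: leq_trans (Gsmooth _ _ _ (idxN i ni) (idxN j nj) h (subsetP (XG i) _ xi)).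
  rewrite leq_mul2l; apply/orP; right; apply: subset_leq_card; apply/subsetP => y.
  rewrite inE /fwd e => /andP[/(subsetP (XG j)) yG nf].
  by rewrite inE yG.
- move=> i j x y ij nj h; apply: (Xrun i j) => //; first exact: run_index_eq (ltnW ij) h.
  by apply: h; rewrite leqnn ltnW.
Qed.

(** * From critical tournaments to the Erdos-Hajnal property *)

Lemma trans_set_transitive (T : tournament) (B : {set T}) :
  trans_set B -> transitive_tournament (subtournament B).
Proof.
move=> /trans_setP tB [//|x p] _; apply/negP => /andP[] /=.
have sub_trans : transitive (@arc (subtournament B)).
  by move=> y u z; apply: tB; exact: valP.
move=> /(order_path_min sub_trans) /allP/(_ x).
by rewrite mem_rcons mem_head arc_irr => /(_ isT).
Qed.

Lemma tr_subtournament (T : tournament) (A : {set T}) :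
  tr [set: subtournament A] <= tr A.
Proof.
have [B [_ tB <-]] := trE [set: subtournament A].
rewrite -(card_imset _ val_inj); apply: leq_tr.
  by apply/subsetP => _ /imsetP[x _ ->]; exact: valP.
apply/trans_setP => _ _ _ /imsetP[x xB ->] /imsetP[y yB ->] /imsetP[z zB ->].
exact: (trans_setP _ tB x y z xB yB zB).
Qed.

Lemma contains_subtournament (T H : tournament) (A : {set T}) :
  contains (subtournament A) H -> contains T H.
Proof.
move=> /contains_homP[phi hphi].
by apply: (@contains_hom _ _ (fun x => val (phi x))) => x y /hphi.
Qed.

Section ErdosHajnal.
Import Order.TTheory GRing.Theory Num.Theory.
Local Open Scope ring_scope.

(* The exponent solves [K `^ eps = K / (K - 1)], so that passing from T to a set A
   violating [crit T K] costs at most what it gains. *)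
Lemma EH_of_crit (R : realType) (H : tournament) K : (1 < K)%N ->
  (forall T : tournament, (1 < #|T|)%N -> crit T K -> contains T H) ->
  satisfies_Erdos_Hajnal R H.
Proof.
move=> K1 hK.
pose eps : R := ln (K%:R / K.-1%:R) / ln K%:R.
have K0 : 0 < K%:R :> R by rewrite ltr0n ltnW.
have K'0 : 0 < K.-1%:R :> R by rewrite ltr0n; case: (K) K1 => [|[]].
have lnK0 : 0 < ln (K%:R : R) by rewrite ln_gt0 // ltr1n.
have eps0 : 0 < eps.
  by rewrite divr_gt0 // ln_gt0 // ltr_pdivlMr // mul1r ltr_nat prednK // ltnW.
have Keps : K%:R `^ eps = K%:R / K.-1%:R.
  by rewrite /powR gt_eqF // /eps divfK ?gt_eqF // lnK // posrE divr_gt0.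
have main n (T : tournament) : (#|T| <= n)%N -> ~ contains T H ->
    (#|T|%:R : R) `^ eps <= (tr [set: T])%:R.
  elim: n T => [|n IH] T Tn nTH.
    by rewrite leqn0 in Tn; rewrite (eqP Tn) powR0 ?gt_eqF.
  have [T1|T1] := leqP #|T| 1.
    have [T0|/card_gt0P[x _]] := posnP #|T|; first by rewrite T0 powR0 ?gt_eqF.
    apply: (@le_trans _ _ (1 `^ eps)).
      by apply: ge0_ler_powR; rewrite ?nnegrE ?(ltW eps0) ?ler01 ?ler0n ?lern1.
    rewrite powR1 ler1n -(cards1 x); apply: leq_tr; rewrite ?subsetT //.
    by apply: trans_set_small; rewrite cards1.
  have [/(hK T T1)//|] := boolP (crit T K).
  (* A set [A] violating [crit T K] has a smaller [tr], hence is proper, and the induction applies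
     to it. *)
  rewrite negb_forall => /existsP[A]; rewrite negb_imply -ltnNge => /andP[TA trA].
  have trA' : (tr A < tr [set: T])%N by move: trA; case: (K) K1 => //= k; nia.
  have AT : (#|subtournament A| <= n)%N.
    rewrite card_sig -ltnS; apply: leq_trans Tn; rewrite ltnNge; apply/negP => h.
    suff eA : A = [set: T] by rewrite eA ltnn in trA'.
    by apply/eqP; rewrite eqEcard subsetT cardsT.
  have := IH _ AT (fun h => nTH (contains_subtournament h)).
  rewrite card_sig => hA.
  (* [|T|^eps <= (K |A|)^eps = K / (K - 1) * |A|^eps <= K / (K - 1) * tr A <= tr T]. *)
  apply: (@le_trans _ _ ((K%:R * #|A|%:R) `^ eps)).
    by apply: ge0_ler_powR; rewrite ?nnegrE ?(ltW eps0) -?natrM ?ler0n ?ler_nat.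
  rewrite powRM ?(ltW K0) // Keps mulrAC ler_pdivrMr //.
  apply: (@le_trans _ _ (K%:R * (tr A)%:R)).
    rewrite ler_pM2l //; apply: le_trans hA _.
    by rewrite ler_nat tr_subtournament.
  by rewrite -!natrM ler_nat [leqRHS]mulnC ltnW.
exists eps => // T nTH; have [B [_ tB eB]] := trE [set: T].
by exists B; [exact: trans_set_transitive|rewrite eB; exact: (main #|T|)].
Qed.

(** Reversing all arcs keeps the transitive sets, since a cycle read backwards is a cycle of the
    complement. *)
Lemma EH_complement (R : realType) (H H' : tournament) :
  isomorphic H (complement H') ->
  satisfies_Erdos_Hajnal R H' -> satisfies_Erdos_Hajnal R H.
Proof.
move=> [phi phi_bij phi_mono] [eps eps0 heps]; exists eps => // T nTH.
have [|S tS hS] := heps (complement T).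
  move=> /contains_homP[psi hpsi]; apply: nTH.
  apply: (@contains_hom T H (fun x => psi (phi x))) => x y.
  by rewrite -phi_mono => /hpsi.
exists S => // c c0; have := tS (rev c); rewrite rev_cycle rev_uniq; apply.
by rewrite -size_eq0 size_rev size_eq0.
Qed.

Lemma EH_isomorphic (R : realType) (H H' : tournament) :
  isomorphic H H' -> satisfies_Erdos_Hajnal R H' -> satisfies_Erdos_Hajnal R H.
Proof.
move=> [phi phi_bij phi_mono] [eps eps0 heps]; exists eps => // T nTH.
apply: heps => /contains_homP[psi hpsi]; apply: nTH.
apply: (@contains_hom T H (fun x => psi (phi x))) => x y.
by rewrite -phi_mono => /hpsi.
Qed.

End ErdosHajnal.

(** * Backward arcs *)

Section Picking.
Variable T : tournament.
Implicit Types (X : nat -> {set T}) (D : seq (nat * T)) (tau : pred nat).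

Lemma restrict_before D X i x j y : (i, x) \in D -> y \in restrict D X j -> i < j ->
  arc x y.
Proof.
by move=> xD yj ij; have := restrict_fwd xD _ yj; rewrite /fwd ij ltn_eqF //; apply.
Qed.

Lemma restrict_after D X i x j y : (i, x) \in D -> y \in restrict D X j -> j < i ->
  arc y x.
Proof.
move=> xD yj ij; have := restrict_fwd xD _ yj.
by rewrite /fwd gtn_eqF // ltnNge ltnW //; apply.
Qed.

Lemma slots_back tau n k l X K c i j (A B : {set T}) : crit T K -> 1 < #|T| -> c < K -> 2 < K ->
  slots tau n k l X -> i < j < n -> A \subset X i -> B \subset X j ->
  #|T| <= c * #|A| -> #|T| <= c * #|B| ->
  exists x y, [/\ x \in A, y \in B & arc y x].
Proof.
move=> cK T1 cK' K2 sX /andP[ij jn] /subsetP AX /subsetP BX hA hB.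
have ij' : i != j by rewrite ltn_eqF.
have [x [y [xA yB nxy]]] := crit_back cK T1 cK' K2 hA hB ij'; exists x, y; split=> //.
have := fwdNarc (slots_neq sX (ltn_trans ij jn) jn ij' (AX x xA) (BX y yB)) nxy.
by rewrite ij.
Qed.

Lemma hit_before tau n k l X i j x : slots tau n k l X -> i < n -> j < i ->
  x \in hit X i j -> x \in X i /\ exists2 y, y \in X j & arc x y.
Proof.
move=> sX ni ij /hitP[xi [y yj nxy]]; split=> //; exists y => //.
have := fwdNarc (slots_neq sX ni (ltn_trans ij ni) (negbT (gtn_eqF ij)) xi yj) nxy.
by rewrite ltnNge ltnW.
Qed.

Lemma hit_after tau n k l X i j x : slots tau n k l X -> j < n -> i < j ->
  x \in hit X i j -> x \in X i /\ exists2 y, y \in X j & arc y x.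
Proof.
move=> sX nj ij /hitP[xi [y yj nxy]]; split=> //; exists y => //.
have := fwdNarc (slots_neq sX (ltn_trans ij nj) nj (negbT (ltn_eqF ij)) xi yj) nxy.
by rewrite ij.
Qed.

Lemma hit_sub X i j : hit X i j \subset X i.
Proof. by apply/subsetP => x /hitP[]. Qed.

(* Otherwise every component of the graph of backward arcs between V and U lies in
   one class of the map sending a vertex to its inneighbourhood in Y; these classes
   meet V in small sets, so they can be divided into two parts such that V in one
   part and U in the other are both large, hence joined by a backward arc. *)
Lemma crit_distinguish K c (V U Y : {set T}) : crit T K -> 1 < #|T| -> 6 * c + 2 < K ->
  #|T| <= c * #|V| -> #|T| <= c * #|U| -> #|T| <= c * #|Y| ->
  {in V & U, forall x y, x != y} -> {in V & Y, forall x y, x != y} ->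
  {in V, forall v, 2 * #|[set y in Y | arc y v]| <= #|Y|} ->
  exists v u y, [/\ v \in V, u \in U, y \in Y, arc u v & arc y u = ~~ arc y v].
Proof.
move=> cK T1 cK' hV hU hY VU VY Yhalf.
have [/existsP[v /existsP[u /existsP[y /and5P[]]]]|nex] := boolP [exists v, exists u, exists y,
    [&& v \in V, u \in U, y \in Y, arc u v & arc y u == ~~ arc y v]].
  by move=> *; exists v, u, y; split=> //; apply/eqP.
exfalso; pose N x := [set y in Y | arc y x].
(* Failure means that vertices joined by a backward arc have the same inneighbours in [Y]. *)
have same u v : v \in V -> u \in U -> arc u v -> N u = N v.
  move=> vV uU uv; apply/setP => y; rewrite !inE; case yY: (y \in Y) => //=.
  apply/eqP; apply: contraNT nex => h; apply/existsP; exists v; apply/existsP; exists u.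
  by apply/existsP; exists y; rewrite vV uU yY uv /=; case: (arc y u) (arc y v) h => -[].
have K2 : 2 < K by lia.
have back (A B : {set T}) c' : c' < K -> {in A & B, forall x y, x != y} ->
    #|T| <= c' * #|A| -> #|T| <= c' * #|B| -> exists x y, [/\ x \in A, y \in B & arc y x].
  move=> c'K AB hA hB; have [x [y [xA yB nxy]]] := crit_back cK T1 c'K K2 hA hB (isT : 0 != 1).
  by exists x, y; split=> //; exact: (fwdNarc (AB x y xA yB) nxy).
pose part (W : {set T}) (F : {set {set T}}) := [set x in W | N x \in F].
have part_sub (W : {set T}) F : part W F \subset W.
  by apply/subsetP => x; rewrite inE => /andP[].
have no_cross (F F' : {set {set T}}) : [disjoint F & F'] ->
    forall c', c' < K -> #|T| <= c' * #|part V F| -> #|T| <= c' * #|part U F'| -> False.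
  move=> FF' c' c'K hF hF'.
  have [|v [u [vF uF uv]]] := back _ _ c' c'K _ hF hF'.
    by move=> x y /(subsetP (part_sub _ _)) xV /(subsetP (part_sub _ _)); exact: VU.
  move: vF uF; rewrite !inE => /andP[vV NF] /andP[uU NF'].
  by move/disjointFr: FF' => /(_ _ NF); rewrite -(same u v) // NF'.
(* If the class of [S] were larger, no arc would run to it from [Y :\: S], which is at least half of
   [Y], against [back]. *)
have small S : 6 * #|part V [set S]| <= #|V|.
  rewrite leqNgt; apply/negP => hS.
  have c0 : 0 < c by case: (c) hV => //; rewrite mul0n; lia.
  have [v vS] : exists v, v \in part V [set S].
    by apply/card_gt0P; move: hS; case: #|part V _| => //; rewrite muln0.
  have SE : S = N v by move: vS; rewrite !inE => /andP[_ /eqP].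
  have vV := subsetP (part_sub _ _) v vS.
  have hY' : #|Y| <= 2 * #|Y :\: S|.
    have := Yhalf v vV; rewrite -/(N v) -SE => h.
    apply: leq_card_double; last exact: subsetDl.
    apply: leq_trans h; rewrite leq_mul2l; apply: subset_leq_card.
    by apply/subsetP => y; rewrite !inE negb_and negbK => /andP[/orP[//|/negPf->]].
  have [||||x [y [xS]]] := back (part V [set S]) (Y :\: S) (6 * c); first by lia.
  - by move=> x y /(subsetP (part_sub _ _)) xV; rewrite inE => /andP[_]; exact: VY.
  - apply: leq_trans hV _; rewrite [6 * c]mulnC -mulnA leq_mul2l; apply/orP; right; exact: ltnW.
  - apply: leq_trans hY _; rewrite [6 * c]mulnC -mulnA leq_mul2l; apply/orP; right.
    by apply: leq_trans hY' _; rewrite leq_mul2r orbT.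
  rewrite inE => /andP[yS yY] yx; move: xS; rewrite !inE => /andP[_ /eqP xS].
  by case/negP: yS; rewrite -xS inE yY.
(* A minimal family [F] of classes holding a third of [V] holds at most half of it, since one class
   holds at most a sixth. Whichever of [F] and its complement holds half of [U], the other holds a
   third of [V]. *)
pose big : pred {set {set T}} := fun F => #|V| <= 3 * #|part V F|.
have PT : big setT.
  rewrite /big (_ : part V setT = V) ?leq_pmull //.
  by apply/setP => x; rewrite !inE andbT.
case: (arg_minnP (fun F : {set {set T}} => #|F|) PT) => F; rewrite /big => hF Fmin.
have V0 : 0 < #|V| by case: #|V| hV => //; rewrite muln0; lia.
have [S SF] : exists S, S \in F.
  apply/set0Pn; apply: contraTneq hF => ->; rewrite -ltnNge.
  rewrite (_ : part V set0 = set0) ?cards0 //.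
  by apply/setP => x; rewrite !inE andbF.
have hFS : 3 * #|part V (F :\ S)| < #|V|.
  rewrite ltnNge; apply/negP => /Fmin; rewrite (cardsD1 S F) SF; lia.
have FE : #|part V F| <= #|part V (F :\ S)| + #|part V [set S]|.
  apply: leq_trans (leq_card_setU _ _).1; apply: subset_leq_card; apply/subsetP => x.
  by rewrite !inE => /andP[-> ->]; case: eqP.
have partC (W : {set T}) : #|W| = #|part W F| + #|part W (~: F)|.
  rewrite -(cardsID (part W F) W); congr (_ + _); apply: eq_card => x; rewrite !inE.
    by case: (x \in W).
  by case: (x \in W); rewrite ?andbF //= andbT.
have hVC := partC V; have hUC := partC U; have hS := small S.
have Vc c1 m : #|V| <= c1 * m -> c1 <= 6 -> #|T| <= 6 * c * m.
  move=> h c6; apply: leq_trans hV _; rewrite [6 * c]mulnC -mulnA leq_mul2l; apply/orP; right.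
  by apply: leq_trans h _; rewrite leq_mul2r c6 orbT.
have Uc c1 m : #|U| <= c1 * m -> c1 <= 6 -> #|T| <= 6 * c * m.
  move=> h c6; apply: leq_trans hU _; rewrite [6 * c]mulnC -mulnA leq_mul2l; apply/orP; right.
  by apply: leq_trans h _; rewrite leq_mul2r c6 orbT.
have [hU1|hU1] := leqP #|U| (2 * #|part U (~: F)|).
  apply: (no_cross F (~: F) _ (6 * c)); [|lia|exact: Vc hF _|exact: Uc hU1 _].
  by rewrite -setI_eq0 setICr.
apply: (no_cross (~: F) F _ (6 * c)); [|lia|apply: (Vc 2)|apply: (Uc 2)]; try lia.
by rewrite -setI_eq0 setIC setICr.
Qed.

End Picking.

Lemma product_contains (T H1 H2 : tournament) (f1 : H1 -> nat) (f2 : H2 -> nat)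
    (f12_inj : injective (sum_fun f1 f2)) (phi1 : H1 -> T) (phi2 : H2 -> T) :
  {homo phi1 : x y / arc x y} -> {homo phi2 : x y / arc x y} ->
  (forall x y, if f1 x < f2 y then arc (phi1 x) (phi2 y) else arc (phi2 y) (phi1 x)) ->
  contains T (product f12_inj).
Proof.
move=> hom1 hom2 cross.
have ob_homo (H : tournament) (f : H -> nat) (x y : H) : injective f ->
    ob_arc f (backward f) x y -> arc x y.
  move=> f_inj; rewrite /ob_arc /backward; case: ltnP => [yx|_ /andP[xy]].
    by rewrite andbT.
  rewrite xy andbT => nyx; rewrite (arc_total (y := y)) //.
  by apply: contraTneq xy => ->; rewrite ltnn.
apply: (@contains_hom T (product f12_inj)
  (fun u => match u with inl x => phi1 x | inr y => phi2 y end)) => -[x|x] [y|y] h.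
- by apply/hom1/ob_homo; [move=> a b e; have /(@f12_inj (inl a) (inl b)) [] := e|exact: h].
- by have := cross x y; move: h; rewrite /= /ob_arc /=; case: ltngtP.
- by have := cross y x; move: h; rewrite /= /ob_arc /=; case: ltngtP.
- by apply/hom2/ob_homo; [move=> a b e; have /(@f12_inj (inr a) (inr b)) [] := e|exact: h].
Qed.

(** * Galaxies *)

Section Block.
Variables (G : tournament) (g : G -> nat) (ctr : {set G} -> G) (s : nat).
Hypothesis g_gal : galaxy_ordering g ctr.
Hypothesis s_split : forall K, K \in stars g ->
  {in leaves ctr K &, forall x y, ~~ (g x <= s < g y)}.

Let g_inj : injective g. Proof. by case: g_gal => -[]. Qed.

Definition comp (x : G) : {set G} := [set y | connect (backgraph g) x y].

Let back_sym : symmetric (backgraph g).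
Proof. by move=> x y; rewrite /backgraph orbC. Qed.

Let conn_sym : connect_sym (backgraph g).
Proof. exact: sym_connect_sym. Qed.

Lemma comp_refl x : x \in comp x.
Proof. by rewrite inE connect0. Qed.

Lemma compE x y : y \in comp x -> comp y = comp x.
Proof.
rewrite inE => xy; apply/setP => z; rewrite !inE.
by apply/esym/same_connect.
Qed.

Lemma comp_components x : comp x \in components g.
Proof. by apply/imsetP; exists x. Qed.

(** The map [par] that presents a galaxy to [slots_embed_stars]. *)
Definition parent x := if 1 < #|comp x| then ctr (comp x) else x.

Lemma comp_star x : 1 < #|comp x| ->
  star_with_center g (comp x) (ctr (comp x)) /\
  ({in comp x, forall y, g (ctr (comp x)) <= g y} \/
   {in comp x, forall y, g y <= g (ctr (comp x))}).
Proof.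
move=> x1; have [_ h _] := g_gal.
by case: (h _ (comp_components x)) => [e|[? ?]|[? ?]]; [rewrite e in x1|auto|auto].
Qed.

Lemma parent_comp x : parent x \in comp x.
Proof.
rewrite /parent; case: ifP => [x1|_]; last exact: comp_refl.
by have [[]] := comp_star x1.
Qed.

Lemma parentK x : parent (parent x) = parent x.
Proof.
have e := compE (parent_comp x).
rewrite -[LHS]/(if 1 < #|comp (parent x)| then ctr (comp (parent x)) else parent x) e.
by rewrite /parent; case: (1 < #|comp x|).
Qed.

Lemma backgraph_parent x y :
  x != y -> backgraph g x y = (parent x == y) || (parent y == x).
Proof.
move=> xy; have [cxy|ncxy] := boolP (y \in comp x); last first.
  have -> : backgraph g x y = false.
    by apply: contraNF ncxy => h; rewrite inE connect1.
  apply/esym/norP; split; apply: contraNneq ncxy => e; first by rewrite -e parent_comp.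
  by rewrite -e (compE (parent_comp y)) comp_refl.
have x1 : 1 < #|comp x|.
  by apply/card_gt1P; exists x, y; rewrite comp_refl.
have [[_ _ h] _] := comp_star x1.
rewrite (h x y) ?comp_refl // /parent (compE cxy) x1 ![ctr _ == _]eq_sym.
move: (ctr (comp x)) => c; case: (eqVneq x c) xy => [->|_]; by case: (eqVneq y c).
Qed.

(** Isolated vertices are not centers in this sense, so they may sit in transitive slots. *)
Definition is_center z := [exists x, (x != z) && (parent x == z)].

Lemma is_center_parent z : is_center z -> parent z = z.
Proof. by move=> /existsP[x /andP[_ /eqP <-]]; rewrite parentK. Qed.

(** The center of the star of [x] is extreme in its star; for the other stars this is the galaxy
    condition. *)
Lemma center_between x y z : parent x = parent y -> parent x != x -> parent y != y ->
  is_center z -> ~~ (g x < g z < g y).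
Proof.
move=> exy px py /existsP[w /andP[wz /eqP pw]].
have big_comp u : parent u != u -> 1 < #|comp u|.
  by apply: contraR => h; rewrite /parent (negPf h).
have pctr u : parent u != u -> parent u = ctr (comp u).
  by move=> /big_comp h; rewrite /parent h.
have cx : comp y = comp x.
  by rewrite -(compE (parent_comp y)) -exy (compE (parent_comp x)).
have pw' : parent w != w by rewrite pw eq_sym.
have starK u : parent u != u -> comp u \in stars g.
  by move=> /big_comp h; rewrite inE comp_components h.
have leaf u : parent u != u -> u \in leaves ctr (comp u).
  by move=> h; rewrite !inE connect0 andbT -pctr // eq_sym.
have zE : z = ctr (comp w) by rewrite -pw pctr.
have [e|ne] := eqVneq (comp w) (comp x).
  rewrite zE e; have [_ []] := comp_star (big_comp x px).
    by move=> /(_ x (comp_refl x)); rewrite leqNgt => /negPf->.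
  by move=> /(_ y); rewrite -cx comp_refl leqNgt => /(_ isT) /negPf->; rewrite andbF.
have [_ _ h] := g_gal; rewrite zE; apply: (h _ _ (starK w pw') (starK x px) ne).
  exact: leaf.
by rewrite -cx leaf.
Qed.

(** The galaxy follows position [o] in its own order, with a gap at [o + s + 1] for the vertex
    [h_7]. *)
Definition block_pos o (x : G) : nat := o + (if g x <= s then g x else (g x).+1).

Lemma block_pos_ltn o x y : (block_pos o x < block_pos o y) = (g x < g y).
Proof. by rewrite /block_pos ltn_add2l; case: (leqP (g x) s); case: (leqP (g y) s); lia. Qed.

Lemma block_pos_inj o : injective (block_pos o).
Proof. by move=> x y e; apply: g_inj; have := block_pos_ltn o x y; have := block_pos_ltn o y x; rewrite e ltnn; lia. Qed.

Lemma block_pos_bound o x : o < block_pos o x <= o + #|G|.+1.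
Proof.
have [[_ /(_ x)/andP[g1 g2]] _ _] := g_gal; have {}g2 : g x <= #|G| by [].
rewrite /block_pos; case: (leqP (g x) s); lia.
Qed.

Lemma block_pos_neq o x : block_pos o x != o + s.+1.
Proof. by rewrite /block_pos eqn_add2l; case: (leqP (g x) s) => h; apply/eqP; lia. Qed.

(** Only transitive slots lie between two leaves of a star: no center, by [center_between], and not
    the gap, by [s_split]. *)
Lemma slots_embed_block (tau : pred nat) n o : o + #|G|.+1 < n ->
  (forall z, is_center z -> tau (block_pos o z)) ->
  (forall m, o < m <= o + #|G|.+1 -> m != o + s.+1 ->
     (forall z, is_center z -> block_pos o z != m) -> ~~ tau m) ->
  exists2 l, 0 < l & forall k, exists2 K, 0 < K &
    forall (T : tournament) (X : nat -> {set T}),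
      1 < #|T| -> crit T K -> slots tau n k l X ->
      exists2 psi : G -> T, {homo psi : x y / arc x y} &
        forall x, psi x \in X (block_pos o x).
Proof.
move=> on tau_ctr tau_other.
have leaf_nctr x z : parent x != x -> is_center z -> z != x.
  by move=> px /is_center_parent pz; apply: contraNneq px => <-; rewrite pz.
have [||||l l0 hl] := @slots_embed_stars G (block_pos o) parent tau n (@block_pos_inj o).
- by move=> x; have := block_pos_bound o x; lia.
- exact: parentK.
- move=> x px; have xc : is_center (parent x).
    by apply/existsP; exists x; rewrite eq_sym px /=.
  rewrite (tau_ctr _ xc) andbT; apply: tau_other; [exact: block_pos_bound|exact: block_pos_neq|].
  by move=> z zc; rewrite (inj_eq (@block_pos_inj o)) leaf_nctr.
- move=> x y m exy px py /andP[xm my].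
  have xb := block_pos_bound o x; have yb := block_pos_bound o y.
  apply: tau_other; first by lia.
    have cx : comp y = comp x.
      by rewrite -(compE (parent_comp y)) -exy (compE (parent_comp x)).
    have x1 : 1 < #|comp x| by apply: contraR px => h; rewrite /parent (negPf h).
    have Kx : comp x \in stars g by rewrite inE comp_components x1.
    have leaf u : comp u = comp x -> parent u != u -> u \in leaves ctr (comp x).
      move=> <-; rewrite /parent; case: ifP => [_|_]; last by rewrite eqxx.
      by rewrite !inE connect0 andbT eq_sym.
    have := s_split Kx (leaf x erefl px) (leaf y cx py).
    apply: contraNneq => em; move: xm my; rewrite em /block_pos !leq_add2l.
    by case: (leqP (g x) s); case: (leqP (g y) s); lia.
  move=> z zc; have := center_between exy px py zc; apply: contraNneq => ez.
  rewrite -!(block_pos_ltn o) ez; apply/andP; split.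
    by rewrite ltn_neqAle xm andbT -ez (inj_eq (@block_pos_inj o)) eq_sym leaf_nctr.
  by rewrite ltn_neqAle my andbT -ez (inj_eq (@block_pos_inj o)) leaf_nctr.
exists l => // k; have [K K0 hK] := hl k; exists K => // T X T1 cK sX.
have [phi phiX phi_arc] := hK T X T1 cK sX; exists phi => // x y xy.
have nxy := arc_neq xy.
have := backgraph_parent nxy; rewrite /backgraph /backward xy (negPf (arc_asym xy)) orbF /= => e.
have [h|h|h] := ltngtP (g x) (g y).
- have := phi_arc x y; rewrite block_pos_ltn h -e ltnNge ltnW //=; exact.
- by have := phi_arc y x; rewrite block_pos_ltn h orbC -e h; exact.
- by rewrite (g_inj h) eqxx in nxy.
Qed.

End Block.

(** * Right pseudogalaxies *)

Lemma of_pairs_homo (T : tournament) n B (c : nat -> T) :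
  (forall i j, 0 < i -> i < j -> j <= n ->
     if (j, i) \in B then arc (c j) (c i) else arc (c i) (c j)) ->
  {homo (fun x : of_pairs n B => c (numbering x)) : x y / arc x y}.
Proof.
move=> hc x y; rewrite /= /ob_arc /=; case: ifP => [yx xy|_ /andP[xy nyx]].
  by have := hc (numbering y) (numbering x) isT yx (ltn_ord x); rewrite xy.
by have := hc (numbering x) (numbering y) isT xy (ltn_ord y); rewrite (negPf nyx).
Qed.

Lemma slots_back_whole (T : tournament) tau n k l (X : nat -> {set T}) K i j :
  crit T K -> 1 < #|T| -> k < K -> 2 < K -> slots tau n k l X -> i < j < n ->
  tau i -> tau j -> exists x y, [/\ x \in X i, y \in X j & arc y x].
Proof.
move=> cK T1 kK K2 sX ij ti tj; have /andP[ij' jn] := ij.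
apply: (slots_back cK T1 kK K2 sX ij (subxx _) (subxx _)).
  exact: (slots_lin sX (ltn_trans ij' jn) ti).
exact: (slots_lin sX jn tj).
Qed.

(* lia is slow in the presence of the many combinatorial hypotheses below. *)
Local Ltac nat_lia :=
  repeat match goal with
  | h : ?P |- _ =>
    match P with
    | is_true (leq _ _) => fail 1
    | is_true (andb _ _) => fail 1
    | @eq nat _ _ => fail 1
    | _ => clear h
    end
  end; lia.

Section RightPseudogalaxy.
Variables (G : tournament) (g : G -> nat) (ctr : {set G} -> G) (s : nat).
Hypotheses (g_gal : galaxy_ordering g ctr) (sG : 1 <= s <= #|G|).
Hypothesis s_split : forall K, K \in stars g ->
  {in leaves ctr K &, forall x y, ~~ (g x <= s < g y)}.

Let pos := block_pos g s.

Definition pseudo : tournament := product (rho_inj (s := s) (galaxy_numbering g_gal)).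

Definition block_embeds (T : tournament) (tau : pred nat) n k l o := forall X : nat -> {set T}, slots tau n k l X ->
  exists2 psi : G -> T, {homo psi : x y / arc x y} & forall x, psi x \in X (pos o x).

(** [c i] is the image of [h_i] and [sl i] its slot. As [h_1, ..., h_6] precede the block and [h_7]
    sits in its gap, the galaxy embedded in the restricted slots has the right arcs to all seven. *)
Lemma pseudo_of_core (T : tournament) tau n k l (X : nat -> {set T}) o (c : nat -> T) (sl : nat -> nat) :
  slots tau n k (2 * l) X -> 7 <= l -> o + #|G|.+1 < n ->
  (forall i, 0 < i <= 7 -> c i \in X (sl i)) ->
  (forall i, 0 < i <= 6 -> sl i <= o) -> sl 7 = o + s.+1 ->
  block_embeds T tau n (2 * k) l o ->
  (forall i j, 0 < i -> i < j -> j <= 7 ->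
     if (j, i) \in [:: (4, 1); (6, 2); (6, 1); (5, 3); (7, 5)]
     then arc (c j) (c i) else arc (c i) (c j)) ->
  contains T pseudo.
Proof.
move=> sX l7 on cX sl6 sl7 hblock hc.
have sln i : 0 < i <= 7 -> sl i < n.
  move=> /andP[i0]; rewrite leq_eqVlt => /predU1P[->|i7]; first by rewrite sl7; case/andP: sG; lia.
  by have := sl6 i; rewrite i0 -ltnS i7 => /(_ isT); lia.
pose D := [seq (sl i, c i) | i <- iota 1 7].
have DP i : 0 < i <= 7 -> (sl i, c i) \in D.
  by move=> hi; apply/mapP; exists i; rewrite // mem_iota add1n ltnS.
have [|psi hpsi psiX] := hblock (restrict D X).
  apply: slots_restrict sX _ _; [by lia| |by rewrite size_map size_iota].
  move=> d /mapP[i]; rewrite mem_iota add1n ltnS => hi -> /=.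
  by rewrite sln // cX.
apply: (product_contains (phi2 := psi) _ (of_pairs_homo hc)) => //.
move=> x y; rewrite /= /rho1 /rho2.
have [_ /(_ y)/andP[g1 _]] := galaxy_numbering g_gal.
have hi : 0 < numbering x <= 7 by rewrite /numbering ltn_ord.
have [x6|x7] := leqP (numbering x) 6.
  rewrite ifT; last by case: ifP => _; rewrite (leq_ltn_trans x6) // -[6]addn0 ?ltn_add2l // addSn; lia.
  apply: restrict_before (DP _ hi) (psiX y) _.
  have := sl6 (numbering x); rewrite x6 andbT => /(_ isT) h.
  by have /andP[] := block_pos_bound s g_gal o y; rewrite /pos; lia.
have {}x7 : numbering x = 7 by lia.
rewrite x7 in hi *; case: (leqP (g y) s) => ys.
  rewrite ifF; last by lia.
  apply: restrict_after (DP _ hi) (psiX y) _.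
  by rewrite sl7 /pos /block_pos ys ltn_add2l ltnS.
rewrite ifT; last by lia.
apply: restrict_before (DP _ hi) (psiX y) _.
by rewrite sl7 /pos /block_pos ifF ?ltn_add2l ?ltnS // leqNgt ys.
Qed.

(* The vertices [r], [q], [p] and a backward arc from [u] to [v] span C_5. *)
Lemma pseudo_of_triple (T : tournament) tau n k l (X : nat -> {set T}) K
    o r v q w u p xr xq xp :
  crit T K -> 1 < #|T| -> 4 * k < K -> 2 < K -> slots tau n k (4 * l) X -> 7 <= l ->
  r < v < q -> q < w < u -> u < p <= o -> o + #|G|.+1 < n ->
  tau v -> tau w -> tau u -> tau (o + s.+1) ->
  block_embeds T tau n (2 * k) l o ->
  xr \in X r -> xq \in X q -> xp \in X p -> arc xq xr -> arc xp xq -> arc xp xr ->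
  contains T pseudo.
Proof.
move=> cK T1 kK K2 sX l7 /andP[rv vq] /andP[qw wu] /andP[up po] on tv tw tu t7 hblock.
move=> xrX xqX xpX qr pq pr; have /andP[s0 sG'] := sG.
pose D := [:: (r, xr); (q, xq); (p, xp)].
have Dr : (r, xr) \in D by rewrite mem_head.
have Dq : (q, xq) \in D by rewrite !inE eqxx orbT.
have Dp : (p, xp) \in D by rewrite !inE eqxx !orbT.
have s1 : slots tau n (2 * k) (2 * l) (restrict D X).
  apply: slots_restrict; [by nat_lia|by apply: slots_mono sX => //; nat_lia| |by rewrite /=; nat_lia].
  by move=> d; rewrite 2!in_cons mem_seq1 => /or3P[] /eqP-> /=; split=> //; nat_lia.
(* The arc from [xu] back to [xv] completes C_5. *)
have [||||xv [xu [xvX xuX uv]]] := slots_back_whole (i := v) (j := u) cK T1 _ K2 s1; [nat_lia|nat_lia|by []|by []|].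
pose D' := [:: (v, xv); (u, xu)].
have Dv : (v, xv) \in D' by rewrite mem_head.
have Du : (u, xu) \in D' by rewrite !inE eqxx orbT.
have s2 : slots tau n (2 * (2 * k)) l (restrict D' (restrict D X)).
  apply: slots_restrict => //; [by nat_lia| |by rewrite /=; nat_lia].
  by move=> d; rewrite in_cons mem_seq1 => /orP[] /eqP-> /=; split=> //; nat_lia.
(* A backward arc from the gap to slot [w] serves as [(h_7, h_5)]. *)
have [||||xw [x7 [xwX x7X h7w]]] := slots_back_whole (i := w) (j := o + s.+1) cK T1 _ K2 s2; [nat_lia|nat_lia|by []|by []|].
have xwX1 := restrict_sub xwX; have x7X1 := restrict_sub x7X.
have rv' := restrict_before Dr xvX rv.
have vq' := restrict_after Dq xvX vq.
have [ru qu vp wp] : [/\ r < u, q < u, v < p & w < p] by split; nat_lia.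
have [rw vw] : r < w /\ v < w by split; nat_lia.
have [r7 q7 p7 v7 u7] : [/\ r < o + s.+1, q < o + s.+1, p < o + s.+1, v < o + s.+1 & u < o + s.+1].
  by split; nat_lia.
have vp' := restrict_after Dp xvX vp.
have ru' := restrict_before Dr xuX ru.
have qu' := restrict_before Dq xuX qu.
have up' := restrict_after Dp xuX up.
have rw' := restrict_before Dr xwX1 rw.
have qw' := restrict_before Dq xwX1 qw.
have wp' := restrict_after Dp xwX1 wp.
have vw' := restrict_before Dv xwX vw.
have wu' := restrict_after Du xwX wu.
have r7' := restrict_before Dr x7X1 r7.
have q7' := restrict_before Dq x7X1 q7.
have p7' := restrict_before Dp x7X1 p7.
have v7' := restrict_before Dv x7X v7.
have u7' := restrict_before Du x7X u7.
have {}xvX := restrict_sub xvX; have {}xuX := restrict_sub xuX.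
have {}xwX := restrict_sub xwX1; have {}x7X := restrict_sub x7X1.
(* With this assignment the pairs [(h_4, h_1)] and [(h_5, h_3)] are forward arcs between slots.
   Entry 0 of both lists is a placeholder. *)
apply: (@pseudo_of_core T tau n k l X o
  (nth xr [:: xr; xq; xr; xu; xv; xw; xp; x7]) (nth 0 [:: 0; q; r; u; v; w; p; o + s.+1])) => //.
- by apply: slots_mono sX => //; nat_lia.
- by move=> [|[|[|[|[|[|[|[|i]]]]]]]].
- by move=> [|[|[|[|[|[|[|i]]]]]]] //= _; nat_lia.
- by move=> [|[|[|[|[|[|[|[|i]]]]]]]] // [|[|[|[|[|[|[|[|j]]]]]]]].
Qed.

(** C_5 is sought in slots 0 to 10, around the transitive slots 2, 3, 4. Two blocks for the galaxy
    follow, since in one case the gap of the first block supplies a vertex of the triple. *)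
Lemma pseudo_of_slots (T : tournament) tau n k l (X : nat -> {set T}) K :
  crit T K -> 1 < #|T| -> 8 * k < K -> 2 < K -> slots tau n k (8 * l) X -> 7 <= l ->
  11 + #|G|.+1 + #|G|.+1 < n ->
  (forall m, m < 11 -> tau m = (m \notin [:: 2; 3; 4])) ->
  tau (10 + s.+1) -> tau (11 + #|G| + s.+1) ->
  block_embeds T tau n (2 * k) l 10 -> block_embeds T tau n (2 * k) l (11 + #|G|) ->
  contains T pseudo.
Proof.
move=> cK T1 kK K2 sX l7 nG tau11 tP tQ hP hQ; have /andP[s0 sG'] := sG.
have sX4 : slots tau n k (4 * l) X by apply: slots_mono sX; nat_lia.
have n11 : 11 < n by nat_lia.
have hit0 : #|T| <= 2 * k * #|hit X 0 4|.
  by apply: (hit_lin cK T1 _ sX); rewrite ?tau11 //; nat_lia.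
have hit10 : #|T| <= 2 * k * #|hit X 10 2|.
  by apply: (hit_lin cK T1 _ sX); rewrite ?tau11 //; nat_lia.
have [||x1 [x5 [x1h x5h h51]]] := slots_back (i := 0) (j := 10) cK T1 _ K2 sX _ (hit_sub _ _ _) (hit_sub _ _ _) hit0 hit10.
- by nat_lia.
- by nat_lia.
have [|//|x1X [z zX z1]] := hit_after sX _ _ x1h; first by nat_lia.
have [|//|x5X [y yX y5]] := hit_before sX _ _ x5h; first by nat_lia.
(* A vertex [q] with [x5 -> q -> x1] gives a triple, completed by slots 1, 5, 6 and the first
   block. *)
have triple j q : j \in [:: 2; 3; 4] -> q \in X j -> arc x5 q -> arc q x1 -> contains T pseudo.
  move=> hj qX q5 q1.
  apply: (@pseudo_of_triple T tau n k l X K 10 0 1 j 5 6 10 x1 q x5) => //; rewrite ?tau11 //;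
    by [nat_lia|move: hj; rewrite !inE => /or3P[] /eqP->].
have [y1|y1] := boolP (arc y x1); first exact: (triple 2 y).
have [z5|z5] := boolP (arc x5 z); first exact: (triple 4 z).
have {}y1 : arc x1 y.
  by rewrite (arc_total (slots_neq sX _ _ _ x1X yX)) //; nat_lia.
have {}z5 : arc z x5.
  by rewrite (arc_total (slots_neq sX _ _ _ zX x5X)) //; nat_lia.
have yz : arc y z.
  apply: (slots_run sX _ _ _ yX zX) => //; first by nat_lia.
  by move=> [|[|[|[|[|m]]]]] // _; rewrite tau11.
pose D := [:: (0, x1); (2, y); (4, z); (10, x5)].
have D1 : (0, x1) \in D by rewrite mem_head.
have Dy : (2, y) \in D by rewrite !inE eqxx orbT.
have Dz : (4, z) \in D by rewrite !inE eqxx !orbT.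
have D5 : (10, x5) \in D by rewrite !inE eqxx !orbT.
have s1 : slots tau n (2 * k) (4 * l) (restrict D X).
  apply: slots_restrict; [by nat_lia|by apply: slots_mono sX => //; nat_lia| |by rewrite /=; nat_lia].
  by move=> d; rewrite 3!in_cons mem_seq1 => /or4P[] /eqP-> /=; split=> //; nat_lia.
(* Any vertex of slot 3 now completes a C_5; one is needed that receives a backward arc from some
   [w], itself receiving one from the gap. *)
have hit7 : #|T| <= 2 * (2 * k) * #|hit (restrict D X) 7 3|.
  by apply: (hit_lin cK T1 _ s1); rewrite ?tau11 //; nat_lia.
have lin7 : #|T| <= 2 * (2 * k) * #|restrict D X (10 + s.+1)|.
  apply: leq_trans (slots_lin s1 _ tP) _; first by nat_lia.
  by rewrite leq_mul2r; apply/orP; right; nat_lia.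
have [||w [h7 [wh h7X h7w]]] := slots_back (i := 7) (j := 10 + s.+1) cK T1 _ K2 s1 _ (hit_sub _ _ _) (subxx _) hit7 lin7.
- by nat_lia.
- by nat_lia.
have [|//|wX [d dX wd]] := hit_before s1 _ _ wh; first by nat_lia.
have wX0 := restrict_sub wX; have dX0 := restrict_sub dX; have h7X0 := restrict_sub h7X.
have [h7d|h7d] := boolP (arc h7 d).
  (* [d], [w], [h7] form a backward transitive triple, and the second block lies to the right of all
     three. *)
  apply: (@pseudo_of_triple T tau n k l X K (11 + #|G|) 3 5 7 8 9 (10 + s.+1) d w h7) => //;
    rewrite ?tau11 //; try nat_lia.
have {}h7d : arc d h7.
  by rewrite (arc_total (slots_neq sX _ _ _ dX0 h7X0)) //; nat_lia.
have d1 := restrict_before D1 dX isT; have w1 := restrict_before D1 wX isT.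
have dy := restrict_before Dy dX isT; have wy := restrict_before Dy wX isT.
have dz := restrict_after Dz dX isT; have wz := restrict_before Dz wX isT.
have d5 := restrict_after D5 dX isT; have w5 := restrict_after D5 wX isT.
have j7 m : m < 11 -> m < 10 + s.+1 by nat_lia.
have h71 := restrict_before D1 h7X (j7 0 isT); have h7y := restrict_before Dy h7X (j7 2 isT).
have h7z := restrict_before Dz h7X (j7 4 isT); have h75 := restrict_before D5 h7X (j7 10 isT).
(* Now [h7] has a backward arc to [w] only, and C_5 is [x1], [y], [d], [z], [x5]. *)
apply: (@pseudo_of_core T tau n k l X 10
  (nth x1 [:: x1; x1; y; d; z; w; x5; h7]) (nth 0 [:: 0; 0; 2; 3; 4; 7; 10; 10 + s.+1])) => //.
- by apply: slots_mono sX => //; nat_lia.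
- by nat_lia.
- by move=> [|[|[|[|[|[|[|[|i]]]]]]]].
- by move=> [|[|[|[|[|[|[|i]]]]]]].
- by move=> [|[|[|[|[|[|[|[|i]]]]]]]] // [|[|[|[|[|[|[|[|j]]]]]]]].
Qed.

Lemma EH_pseudo (R : realType) : satisfies_Erdos_Hajnal R pseudo.
Proof.
have /andP[s0 sG'] := sG.
pose n := 13 + #|G| + #|G|.+1.
pose ctr_slot m := [exists z, is_center g ctr z && ((pos 10 z == m) || (pos (11 + #|G|) z == m))].
pose tau m := [|| (m < 11) && (m \notin [:: 2; 3; 4]), m == 10 + s.+1,
  m == 11 + #|G| + s.+1 | ctr_slot m].
have bound := block_pos_bound s g_gal.
have tau11 m : m < 11 -> tau m = (m \notin [:: 2; 3; 4]).
  move=> m11; rewrite /tau m11 /= (_ : m == 10 + _ = false); last by apply/eqP; lia.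
  rewrite (_ : m == 11 + _ + _ = false); last by apply/eqP; lia.
  rewrite (_ : ctr_slot m = false) ?orbF //; apply/existsP => -[z /andP[_]].
  have /andP[b1 _] := bound 10 z; have /andP[b2 _] := bound (11 + #|G|) z.
  by rewrite /pos => /orP[] /eqP; lia.
have embed o : o = 10 \/ o = 11 + #|G| -> exists2 l, 0 < l & forall k, exists2 K, 0 < K &
    forall T : tournament, 1 < #|T| -> crit T K -> block_embeds T tau n k l o.
  move=> ho.
  have [|||l l0 hl] := @slots_embed_block G g ctr s g_gal s_split tau n o.
  - by rewrite /n; lia.
  - move=> z zc; rewrite /tau (_ : ctr_slot _) ?orbT //; apply/existsP; exists z.
    by rewrite zc /pos; case: ho => ->; rewrite eqxx ?orbT.
  - move=> m mo ms mc; rewrite /tau !negb_or; apply/and4P; split.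
    + by case: ho mo => ->; lia.
    + by case: ho mo ms => ->; lia.
    + by case: ho mo ms => ->; lia.
    + apply/existsP => -[z /andP[zc hz]]; have := mc z zc; rewrite /pos in hz.
      have /andP[b1 b1'] := bound 10 z; have /andP[b2 b2'] := bound (11 + #|G|) z.
      case: ho mo => -> mo; case/orP: hz => /eqP e; rewrite ?e ?eqxx //; lia.
  by exists l => // k; have [K K0 hK] := hl k; exists K => // T T1 cK X sX; exact: hK.
have [lP lP0 hP] := embed 10 (or_introl erefl).
have [lQ lQ0 hQ] := embed (11 + #|G|) (or_intror erefl).
(* The constants are fixed in the order [l], [k], [K]: the block embeddings give [l], [slots_exist]
   then gives [k], and [K] comes last. *)
pose l := maxn 7 (maxn lP lQ).
have l8 : 0 < 8 * l by rewrite muln_gt0 /= leq_max.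
have [k [K0 [K00 hK0]]] := slots_exist pseudo tau n l8.
have [KP KP0 hKP] := hP (2 * k); have [KQ KQ0 hKQ] := hQ (2 * k).
pose K := maxn (maxn K0 (8 * k + 3)) (maxn KP KQ).
apply: (@EH_of_crit R pseudo K); first by rewrite !leq_max addnS !ltnS addn2 /= orbT.
move=> T T1 cK.
have cK' K' : 0 < K' -> K' <= K -> crit T K' by move=> h1 h2; apply: crit_mono cK; rewrite h1.
have block o l' : l' <= l -> block_embeds T tau n (2 * k) l' o -> block_embeds T tau n (2 * k) l o.
  by move=> l'l h X sX; apply: h; apply: slots_mono sX.
have [//|nTH] := EM (contains T pseudo).
have [|X sX] := hK0 T T1 _ nTH; first by apply: cK'; rewrite // !leq_max leqnn.
apply: (@pseudo_of_slots T tau n k l X K) => //.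
- by rewrite /K; lia.
- by rewrite /K; lia.
- by rewrite /l leq_max.
- by rewrite /tau eqxx orbT.
- by rewrite /tau eqxx !orbT.
- apply: (block _ lP); first by rewrite /l; lia.
  by apply: hKP => //; apply: cK'; rewrite // !leq_max leqnn ?orbT.
- apply: (block _ lQ); first by rewrite /l; lia.
  by apply: hKQ => //; apply: cK'; rewrite // !leq_max leqnn ?orbT.
Qed.

End RightPseudogalaxy.

(** * C_5-chains *)

Section C5Chain.
Variable t : nat.

Definition chain : tournament := product (@rho'_inj t).

Definition chain_tau : pred nat := fun m => m \notin [:: 2; 3; 4].

(* Swapping p_(2i-1) and p_(2i) for every i leaves no backward arc in P_(2t+1). *)
Definition tail_pos (p : P t) : nat :=
  10 + (if odd (numbering p) then (numbering p).+1 else (numbering p).-1).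

Definition tail_embeds (T : tournament) n k l := forall X : nat -> {set T},
  slots chain_tau n k l X ->
  exists2 psi : P t -> T, (forall p, psi p \in X (tail_pos p)) &
    forall p q, tail_pos p < tail_pos q -> arc (psi p) (psi q).

Lemma tail_pos_inj : injective tail_pos.
Proof.
move=> p q; rewrite /tail_pos => e; apply: (@numbering_inj (2 * t + 1)).
by move: e; rewrite /numbering; case: ifP; case: ifP => /=; lia.
Qed.

Lemma tail_pos_bound p : 10 < tail_pos p < 13 + 2 * t.
Proof.
have := ltn_ord p; rewrite /tail_pos /numbering; case: ifPn => /=; last by case: (nat_of_ord p); lia.
lia.
Qed.

(** Stars without leaves suffice, as the tail is transitive in the order [tail_pos]. *)
Lemma slots_embed_tail : exists2 l, 0 < l & forall k, exists2 K, 0 < K &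
  forall T : tournament, 1 < #|T| -> crit T K -> tail_embeds T (13 + 2 * t) k l.
Proof.
have [||||l l0 hl] :=
    @slots_embed_stars (P t) tail_pos id chain_tau (13 + 2 * t) tail_pos_inj.
- by move=> p; have /andP[] := tail_pos_bound p.
- by [].
- by move=> p; rewrite eqxx.
- by move=> p q m _; rewrite eqxx.
exists l => // k; have [K K0 hK] := hl k; exists K => // T T1 cK X sX.
have [psi psiX psi_arc] := hK T X T1 cK sX; exists psi => // p q pq.
have pq' : p != q by apply: contraTneq pq => ->; rewrite ltnn.
by have := psi_arc p q pq; rewrite /= (negPf pq') eq_sym (negPf pq').
Qed.

Lemma P_pairs a b : 0 < a <= 2 * t + 1 ->
  ((a, b) \in [seq (2 * i, 2 * i - 1) | i <- iota 1 t]) = ~~ odd a && (b == a.-1).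
Proof.
move=> ha; apply/mapP/andP => [[i]|[ea /eqP->]].
  by rewrite mem_iota => hi [-> ->]; split; [lia|apply/eqP; lia].
by exists a./2; rewrite ?mem_iota; [|congr pair]; lia.
Qed.

(** [c 7] and [c 8] are the images of [p_1] and [p_2]. Only [p_1] precedes [h_6], and [p_2] has an
    arc back to it, so both are placed by hand; the other vertices of [P t] come from the tail. *)
Lemma chain_of_core (T : tournament) k l (X : nat -> {set T}) (c : nat -> T) (sl : nat -> nat) :
  slots chain_tau (13 + 2 * t) k (2 * l) X -> 8 <= l ->
  (forall i, 0 < i <= 8 -> c i \in X (sl i)) ->
  (forall i, 0 < i <= 8 -> sl i <= 9) ->
  tail_embeds T (13 + 2 * t) (2 * k) l ->
  (forall i j, 0 < i -> i < j -> j <= 6 ->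
     if (j, i) \in [:: (4, 1); (5, 2); (5, 1); (6, 3)]
     then arc (c j) (c i) else arc (c i) (c j)) ->
  (forall i, 0 < i <= 5 -> arc (c i) (c 7)) -> arc (c 7) (c 6) ->
  (forall i, 0 < i <= 6 -> arc (c i) (c 8)) -> arc (c 8) (c 7) ->
  contains T chain.
Proof.
move=> sX l8 cX sl9 htail hc c7 c76 c8 c87.
pose D := [seq (sl i, c i) | i <- iota 1 8].
have [|psi psiX psi_arc] := htail (restrict D X).
  apply: slots_restrict sX _ _; [by lia| |by rewrite size_map size_iota].
  move=> d /mapP[i]; rewrite mem_iota add1n ltnS => hi -> /=.
  by split; [have := sl9 i hi; lia|exact: cX].
have c_psi i p : 0 < i <= 8 -> arc (c i) (psi p).
  move=> hi; have iD : (sl i, c i) \in D.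
    by apply/mapP; exists i; rewrite // mem_iota add1n ltnS.
  apply: restrict_before iD (psiX p) _; have := sl9 i hi.
  by have /andP[] := tail_pos_bound p; lia.
pose phi2 (p : P t) := if numbering p == 1 then c 7 else if numbering p == 2 then c 8 else psi p.
apply: (product_contains (phi2 := phi2) _ (of_pairs_homo hc)) => //.
  move=> p q; rewrite /= /ob_arc /phi2.
  have hp : 0 < numbering p <= 2 * t + 1 by rewrite /numbering ltn_ord.
  have hq : 0 < numbering q <= 2 * t + 1 by rewrite /numbering ltn_ord.
  rewrite !P_pairs // => h.
  have [p1|p1] := eqVneq (numbering p) 1.
    move: h; rewrite p1; case: (eqVneq (numbering q) 1) => [->//|q1].
    case: (eqVneq (numbering q) 2) => [->//|q2 _]; exact: c_psi.
  have [p2|p2] := eqVneq (numbering p) 2.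
    move: h; rewrite p2; case: (eqVneq (numbering q) 1) => [//|q1].
    case: (eqVneq (numbering q) 2) => [->//|q2 _]; exact: c_psi.
  have [q1|q1] := eqVneq (numbering q) 1; first by move: h; rewrite q1; case: ifP; lia.
  have [q2|q2] := eqVneq (numbering q) 2; first by move: h; rewrite q2; case: ifP; lia.
  apply: psi_arc; rewrite /tail_pos; move: h.
  by case: ifP; case: ifP; case: ifP; lia.
move=> x p; rewrite /= /rho1' /rho2' /phi2.
have hx : 0 < numbering x <= 6 by rewrite /numbering ltn_ord.
have hp : 0 < numbering p by [].
have [p1|p1] := eqVneq (numbering p) 1.
  rewrite p1 /=; case: (leqP (numbering x) 5) => x5; first by rewrite ifT ?c7 //; lia.
  by rewrite (_ : numbering x = 6) //; lia.
rewrite ifT; last by case: ifP; case: ifP; lia.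
by case: eqP => _; [apply: c8|apply: c_psi]; lia.
Qed.

(** C_5 is sought as for pseudogalaxies, in slots 0 to 6. Slot 8 supplies [h_6], and a backward arc
    between slots 9 and 7 supplies [p_2] and [p_1]; the arc from [p_1] to [h_6] is then a forward
    one. *)
Lemma chain_of_slots (T : tournament) k l (X : nat -> {set T}) K :
  crit T K -> 1 < #|T| -> 12 * k + 3 < K -> slots chain_tau (13 + 2 * t) k (4 * l) X -> 8 <= l ->
  tail_embeds T (13 + 2 * t) (2 * k) (2 * l) -> contains T chain.
Proof.
move=> cK T1 kK sX l8 htail; pose n := 13 + 2 * t.
have K2 : 2 < K by nat_lia.
have hit0 : #|T| <= 2 * k * #|hit X 0 4| by apply: (hit_lin cK T1 _ sX); rewrite //; nat_lia.
have hit6 : #|T| <= 2 * k * #|hit X 6 2| by apply: (hit_lin cK T1 _ sX); rewrite //; nat_lia.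
have [||x1 [x5 [x1h x5h h51]]] := slots_back (i := 0) (j := 6) cK T1 _ K2 sX _ (hit_sub _ _ _) (hit_sub _ _ _) hit0 hit6.
- by nat_lia.
- by nat_lia.
have [|//|x1X [z zX z1]] := hit_after sX _ _ x1h; first by nat_lia.
have [|//|x5X [y yX y5]] := hit_before sX _ _ x5h; first by nat_lia.
have sX4 : slots chain_tau n k (2 * (2 * l)) X by apply: slots_mono sX => //; nat_lia.
have triple j q : j \in [:: 2; 3; 4] -> q \in X j -> arc x5 q -> arc q x1 -> contains T chain.
  move=> hj qX q5 q1; have hj' : 2 <= j <= 4 by move: hj; rewrite !inE => /or3P[] /eqP->.
  pose D := [:: (0, x1); (j, q); (6, x5)].
  have D1 : (0, x1) \in D by rewrite mem_head.
  have Dq : (j, q) \in D by rewrite !inE eqxx orbT.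
  have D5 : (6, x5) \in D by rewrite !inE eqxx !orbT.
  have s1 : slots chain_tau n (2 * k) (2 * l) (restrict D X).
    apply: slots_restrict => //; [by nat_lia| |by rewrite /=; nat_lia].
    by move=> d; rewrite 2!in_cons mem_seq1 => /or3P[] /eqP-> /=; split=> //; nat_lia.
  (* The arc from [u] to [v] completes C_5, and exactly one of the two receives an arc from [w]. A
     rotation of C_5 brings that one to the place of [h_3], with [w] as [h_6]. *)
  have [|||||||v [u [w [vX uX wX uv wuv]]]] :=
      @crit_distinguish T K (2 * k) (restrict D X 1) (restrict D X 5) (restrict D X 8) cK T1.
  - by nat_lia.
  - by apply: (slots_lin s1).
  - by apply: (slots_lin s1).
  - by apply: (slots_lin s1).
  - by move=> a b; apply: (slots_neq s1).
  - by move=> a b; apply: (slots_neq s1).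
  (* By smoothness at most half of slot 8 are inneighbours of a given vertex of slot 1. *)
  - move=> a aX; have h18 : 1 != 8 by [].
    have := slots_smooth s1 (isT : 1 < n) (isT : 8 < n) h18 aX; apply: leq_trans.
    apply: leq_mul; first by nat_lia.
    apply: subset_leq_card; apply/subsetP => b; rewrite !inE => /andP[-> ba].
    by rewrite /fwd /= arc_asym.
  pose D' := [:: (1, v); (5, u); (8, w)].
  have Dv : (1, v) \in D' by rewrite mem_head.
  have Du : (5, u) \in D' by rewrite !inE eqxx orbT.
  have Dw : (8, w) \in D' by rewrite !inE eqxx !orbT.
  have s2 : slots chain_tau n (2 * (2 * k)) l (restrict D' (restrict D X)).
    apply: slots_restrict => //; [by nat_lia| |by rewrite /=; nat_lia].
    by move=> d; rewrite 2!in_cons mem_seq1 => /or3P[] /eqP-> /=; split=> //; nat_lia.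
  have [||||a [b [aX bX ba]]] := slots_back_whole (i := 7) (j := 9) cK T1 _ K2 s2; [nat_lia|nat_lia|by []|by []|].
  have aX1 := restrict_sub aX; have bX1 := restrict_sub bX.
  have [jq j5 q7 q8 q9] : [/\ 1 < j, j < 5, j < 7, j < 8 & j < 9] by split; nat_lia.
  have v1 := restrict_before D1 vX isT; have u1 := restrict_before D1 uX isT.
  have w1 := restrict_before D1 wX isT; have a1 := restrict_before D1 aX1 isT.
  have b1 := restrict_before D1 bX1 isT.
  have vq := restrict_after Dq vX jq; have uq := restrict_before Dq uX j5.
  have wq := restrict_before Dq wX q8; have aq := restrict_before Dq aX1 q7.
  have bq := restrict_before Dq bX1 q9.
  have v5 := restrict_after D5 vX isT; have u5 := restrict_after D5 uX isT.
  have w5 := restrict_before D5 wX isT; have a5 := restrict_before D5 aX1 isT.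
  have b5 := restrict_before D5 bX1 isT.
  have av := restrict_before Dv aX isT; have bv := restrict_before Dv bX isT.
  have au := restrict_before Du aX isT; have bu := restrict_before Du bX isT.
  have aw := restrict_after Dw aX isT; have bw := restrict_before Dw bX isT.
  have vw : v != w by apply: (slots_neq s1 _ _ _ vX wX).
  have uw : u != w by apply: (slots_neq s1 _ _ _ uX wX).
  have vX0 := restrict_sub vX; have uX0 := restrict_sub uX; have wX0 := restrict_sub wX.
  have aX0 := restrict_sub aX1; have bX0 := restrict_sub bX1.
  have slE : (j <= 9) by nat_lia.
  have [wv|wv] := boolP (arc w v); rewrite ?wv ?(negPf wv) /= in wuv.
    have {}uw : arc u w by rewrite (arc_total uw) wuv.
    (* Here [v] is [h_3]. *)
    apply: (@chain_of_core T k (2 * l) X (nth x1 [:: x1; x1; u; v; x5; q; w; a; b])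
      (nth 0 [:: 0; 0; 5; 1; 6; j; 8; 7; 9])) => //; first by nat_lia.
    - by move=> [|[|[|[|[|[|[|[|[|i]]]]]]]]].
    - by move=> [|[|[|[|[|[|[|[|[|i]]]]]]]]].
    - by move=> [|[|[|[|[|[|[|i]]]]]]] // [|[|[|[|[|[|[|i']]]]]]].
    - by move=> [|[|[|[|[|[|i]]]]]].
    - by move=> [|[|[|[|[|[|[|i]]]]]]].
  have {}vw : arc v w by rewrite (arc_total vw).
  (* Here [u] is [h_3]. *)
  apply: (@chain_of_core T k (2 * l) X (nth x1 [:: x1; q; x1; u; v; x5; w; a; b])
    (nth 0 [:: 0; j; 0; 5; 1; 6; 8; 7; 9])) => //; first by nat_lia.
  - by move=> [|[|[|[|[|[|[|[|[|i]]]]]]]]].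
  - by move=> [|[|[|[|[|[|[|[|[|i]]]]]]]]].
  - by move=> [|[|[|[|[|[|[|i]]]]]]] // [|[|[|[|[|[|[|i']]]]]]].
  - by move=> [|[|[|[|[|[|i]]]]]].
  - by move=> [|[|[|[|[|[|[|i]]]]]]].
have [y1|y1] := boolP (arc y x1); first exact: (triple 2 y).
have [z5|z5] := boolP (arc x5 z); first exact: (triple 4 z).
have {}y1 : arc x1 y.
  by rewrite (arc_total (slots_neq sX _ _ _ x1X yX)) //; nat_lia.
have {}z5 : arc z x5.
  by rewrite (arc_total (slots_neq sX _ _ _ zX x5X)) //; nat_lia.
have yz : arc y z.
  apply: (slots_run sX _ _ _ yX zX) => //.
  by move=> [|[|[|[|[|m]]]]].
pose D := [:: (0, x1); (2, y); (4, z); (6, x5)].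
have D1 : (0, x1) \in D by rewrite mem_head.
have Dy : (2, y) \in D by rewrite !inE eqxx orbT.
have Dz : (4, z) \in D by rewrite !inE eqxx !orbT.
have D5 : (6, x5) \in D by rewrite !inE eqxx !orbT.
have s1 : slots chain_tau n (2 * k) (2 * l) (restrict D X).
  apply: slots_restrict => //; [by nat_lia| |by rewrite /=; nat_lia].
  by move=> d; rewrite 3!in_cons mem_seq1 => /or4P[] /eqP-> /=; split=> //; nat_lia.
have hit8 : #|T| <= 2 * (2 * k) * #|hit (restrict D X) 8 3|.
  by apply: (hit_lin cK T1 _ s1); rewrite //; nat_lia.
(* [w] becomes [h_6], and its outneighbour in slot 3 becomes [h_3]. *)
have [w wh] : exists w, w \in hit (restrict D X) 8 3.
  by apply/card_gt0P; move: hit8; case: #|hit _ _ _| => //; rewrite muln0; nat_lia.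
have [//|//|wX [d dX wd]] := hit_before s1 _ _ wh.
pose D' := [:: (3, d); (8, w)].
have Dd : (3, d) \in D' by rewrite mem_head.
have Dw : (8, w) \in D' by rewrite !inE eqxx orbT.
have s2 : slots chain_tau n (2 * (2 * k)) l (restrict D' (restrict D X)).
  apply: slots_restrict => //; [by nat_lia| |by rewrite /=; nat_lia].
  by move=> e; rewrite in_cons mem_seq1 => /orP[] /eqP-> /=; split=> //; nat_lia.
have [||||a [b [aX bX ba]]] := slots_back_whole (i := 7) (j := 9) cK T1 _ K2 s2; [nat_lia|nat_lia|by []|by []|].
have aX1 := restrict_sub aX; have bX1 := restrict_sub bX.
have d1 := restrict_before D1 dX isT; have w1 := restrict_before D1 wX isT.
have a1 := restrict_before D1 aX1 isT; have b1 := restrict_before D1 bX1 isT.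
have dy := restrict_before Dy dX isT; have wy := restrict_before Dy wX isT.
have ay := restrict_before Dy aX1 isT; have byy := restrict_before Dy bX1 isT.
have dz := restrict_after Dz dX isT; have wz := restrict_before Dz wX isT.
have az := restrict_before Dz aX1 isT; have bz := restrict_before Dz bX1 isT.
have d5 := restrict_after D5 dX isT; have w5 := restrict_before D5 wX isT.
have a5 := restrict_before D5 aX1 isT; have b5 := restrict_before D5 bX1 isT.
have ad := restrict_before Dd aX isT; have bd := restrict_before Dd bX isT.
have aw := restrict_after Dw aX isT; have bw := restrict_before Dw bX isT.
have dX0 := restrict_sub dX; have wX0 := restrict_sub wX.
have aX0 := restrict_sub aX1; have bX0 := restrict_sub bX1.
apply: (@chain_of_core T k (2 * l) X (nth x1 [:: x1; x1; y; d; z; x5; w; a; b])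
  (nth 0 [:: 0; 0; 2; 3; 4; 6; 8; 7; 9])) => //; first by nat_lia.
- by move=> [|[|[|[|[|[|[|[|[|i]]]]]]]]].
- by move=> [|[|[|[|[|[|[|[|[|i]]]]]]]]].
- by move=> [|[|[|[|[|[|[|i]]]]]]] // [|[|[|[|[|[|[|i']]]]]]].
- by move=> [|[|[|[|[|[|i]]]]]].
- by move=> [|[|[|[|[|[|[|i]]]]]]].
Qed.

Lemma EH_chain (R : realType) : satisfies_Erdos_Hajnal R chain.
Proof.
have [lT lT0 hT] := slots_embed_tail; pose l := maxn 8 lT.
have l8 : 0 < 4 * l by rewrite muln_gt0 /= leq_max.
have [k [K0 [K00 hK0]]] := slots_exist chain chain_tau (13 + 2 * t) l8.
have [KT KT0 hKT] := hT (2 * k).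
pose K := maxn K0 (maxn (12 * k + 4) KT).
apply: (@EH_of_crit R chain K); first by rewrite /K; lia.
move=> T T1 cK.
have cK' K' : 0 < K' -> K' <= K -> crit T K' by move=> h1 h2; apply: crit_mono cK; rewrite h1.
have [//|nTH] := EM (contains T chain).
have [|X sX] := hK0 T T1 _ nTH; first by apply: cK'; rewrite // leq_max leqnn.
apply: (@chain_of_slots T k l X K) => //.
- by rewrite /K; lia.
- by rewrite leq_max.
- move=> Y sY; apply: hKT => //; first by apply: cK'; rewrite // !leq_max leqnn !orbT.
  by apply: slots_mono sY => //; rewrite /l; lia.
Qed.

End C5Chain.

Theorem theorem19 (R : realType) (H : tournament)
  (hH : left_pseudogalaxy H \/ C5_co_chain H) :
  satisfies_Erdos_Hajnal R H.
Proof.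
case: hH => -[H' hH' isoH]; apply: EH_complement isoH _.
  case: hH' => G [g [ctr [s [g_gal [sG s_split isoH']]]]].
  by apply: EH_isomorphic isoH' _; exact: EH_pseudo.
by case: hH' => t isoH'; apply: EH_isomorphic isoH' _; exact: EH_chain.
Qed.
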